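(* Let $n\ge 1$ be a fixed integer, let $\lambda$ be a partition and let $k\geq 1$ be an integer. Then $$\mathbf{h}_k\,\mathcal{G}_\lambda(X;q)=\sum_\mu q^{s(\mu/\lambda)}\,\mathcal{G}_\mu(X;q),$$ where the sum is over all partitions $\mu$ such that $\mu/\lambda$ is a horizontal $n$-ribbon strip with $k$ ribbons, and $s(\mu/\lambda)$ is the spin of the unique tiling of $\mu/\lambda$ as a horizontal ribbon strip. Also $$\mathbf{e}_k\,\mathcal{G}_\lambda(X;q)=\sum_\mu q^{s(\mu/\lambda)}\,\mathcal{G}_\mu(X;q),$$ where the sum is over all partitions $\mu$ such that $\mu/\lambda$ is a vertical $n$-ribbon strip with $k$ ribbons, and here $s(\mu/\lambda)$ is the spin of the unique tiling of $\mu/\lambda$ as a vertical ribbon strip.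
   Context: $\Lambda$ is the ring of symmetric functions over $\mathbb{C}$ in $X=(x_1,x_2,\ldots)$ and $\Lambda(q)=\Lambda\otimes_{\mathbb{C}}\mathbb{C}(q)$. Ribbons and ribbon functions: fix $n\ge1$. Partitions are identified with their Young diagrams (first row on top); ''connected'' means connected through edges. A ribbon is a connected skew shape with exactly $n$ squares containing no $2\times 2$ square; its spin is its number of rows minus 1. The spin $s(T)$ of a shape tiled by ribbons is the sum of the spins of its ribbons. A horizontal ribbon strip is a skew shape tiled by ribbons such that the topright-most square of every ribbon touches the northern edge of the shape; such a tiling is unique if it exists. A vertical ribbon strip is the conjugate (transpose) of a horizontal ribbon strip. A semistandard ribbon tableau $T$ of shape $\lambda/\mu$ is a chain of partitions $\mu=\mu^0\subset\mu^1\subset\cdots\subset\mu^r=\lambda$ with each $\mu^{i}/\mu^{i-1}$ a (possibly empty) horizontal ribbon strip, whose ribbons are labelled $i$; its weight $w(T)$ is the composition whose $i$-th part is the number of ribbons labelled $i$. For a skew shape $\lambda/\mu$ put $\mathcal{G}_{\lambda/\mu}(X;q)=\sum_T q^{s(T)}\mathbf{x}^{w(T)}$, summed over semistandard ribbon tableaux of shape $\lambda/\mu$; this is known to be a symmetric function. The $n$-core $\tilde\lambda$ of $\lambda$ is the partition obtained by removing $n$-ribbons from $\lambda$ until no longer possible, and $\mathcal{G}_\lambda:=\mathcal{G}_{\lambda/\tilde\lambda}$. The symmetric functions $\mathbf{h}_k,\mathbf{e}_k\in\Lambda(q)$ are defined by $$\sum_k \mathbf{h}_kt^k=\prod_i\prod_{j=0}^{n-1}\frac{1}{1-x_iq^{2j}t},\qquad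 \sum_k\mathbf{e}_kt^k=\prod_i\prod_{j=0}^{n-1}(1+x_iq^{2j}t).$$ *)

(* Defs.v *)
From HB Require Import structures.
From mathcomp Require Import all_boot all_order all_algebra.
From mathcomp Require Import finmap.
From mathcomp Require Import complex.
From mathcomp Require Import boolp classical_sets cardinality fsbigop reals.
From mathcomp Require Import mpoly ring.
From Stdlib Require Import Relation_Operators.

Set Implicit Arguments.
Unset Strict Implicit.
Unset Printing Implicit Defensive.

Import GRing.Theory.

Local Open Scope fset_scope.
Local Open Scope ring_scope.

Record intpart := IntPart {
  parts :> seq nat;
  _ : sorted geq parts && (0%N \notin parts) }.

HB.instance Definition _ := [isSub for parts].
HB.instance Definition _ := [Choice of intpart by <:].

(* The square in row i (from the top) and column j (from the left), both
   counted from 0, is the pair (i, j). *)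
Definition cells := {fset nat * nat}.

Definition diagram (la : intpart) : cells :=
  [fset c in [seq (i, j) | i <- iota 0 (size la),
                           j <- iota 0 (nth 0%N la i)]].

(* Meaningful only when diagram la `<=` diagram mu; this inclusion is always
   required separately. *)
Definition skew (mu la : intpart) : cells := diagram mu `\` diagram la.

Definition adjacent (c d : nat * nat) : bool :=
  [|| (c.1 == d.1) && (c.2.+1 == d.2), (c.1 == d.1) && (d.2.+1 == c.2),
      (c.2 == d.2) && (c.1.+1 == d.1) | (c.2 == d.2) && (d.1.+1 == c.1)].

Definition edge_connected (S : cells) : Prop :=
  forall x y : S, connect (fun u v : S => adjacent (val u) (val v)) x y.

Definition is_ribbon (n : nat) (S : cells) : Prop :=
  [/\ exists al be : intpart, diagram al `<=` diagram be /\ S = skew be al,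
      edge_connected S,
      #|` S| = n
    & ~ exists i j, [/\ (i, j) \in S, (i.+1, j) \in S,
                        (i, j.+1) \in S & (i.+1, j.+1) \in S]].

Definition ribbon_spin (S : cells) : nat := #|` [fset c.1 | c in S]|.-1.

Definition is_tiling (n : nat) (S : cells) (P : {fset cells}) : Prop :=
  [/\ forall B, B \in P -> is_ribbon n B, trivIfset P & fcover P = S].

Definition spin (P : {fset cells}) : nat := (\sum_(B <- P) ribbon_spin B)%N.

Definition is_topright (B : cells) (c : nat * nat) : Prop :=
  c \in B /\ forall d, d \in B -> (c.1 <= d.1)%N /\ (d.2 <= c.2)%N.

Definition touches_north (S : cells) (c : nat * nat) : Prop :=
  c.1 = 0%N \/ (c.1.-1, c.2) \notin S.

Definition is_htiling (n : nat) (S : cells) (P : {fset cells}) : Prop :=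
  is_tiling n S P /\
  forall B, B \in P -> exists2 c, is_topright B c & touches_north S c.

Definition transpose (S : cells) : cells := [fset (c.2, c.1) | c in S].

Definition is_vtiling (n : nat) (S : cells) (P : {fset cells}) : Prop :=
  is_htiling n (transpose S) [fset transpose B | B in P].

(* The tiling of a horizontal (resp. vertical) ribbon strip is unique; fset0 is
   the value on shapes which are not such strips. *)
Definition htiling (n : nat) (S : cells) : {fset cells} :=
  xget fset0 [set P | is_htiling n S P]%classic.

Definition vtiling (n : nat) (S : cells) : {fset cells} :=
  xget fset0 [set P | is_vtiling n S P]%classic.

Definition is_hstrip (n : nat) (mu la : intpart) : Prop :=
  diagram la `<=` diagram mu /\ exists P, is_htiling n (skew mu la) P.

Definition is_vstrip (n : nat) (mu la : intpart) : Prop :=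
  diagram la `<=` diagram mu /\ exists P, is_vtiling n (skew mu la) P.

Definition hspin (n : nat) (mu la : intpart) : nat :=
  spin (htiling n (skew mu la)).

(* The ribbons are those of mu / la itself, not their transposes: the spin
   still counts rows. *)
Definition vspin (n : nat) (mu la : intpart) : nat :=
  spin (vtiling n (skew mu la)).

Definition hcount (n : nat) (mu la : intpart) : nat :=
  #|` htiling n (skew mu la)|.

Definition vcount (n : nat) (mu la : intpart) : nat :=
  #|` vtiling n (skew mu la)|.

(* Semistandard ribbon tableaux of shape la / mu with labels among m labels:
   chains mu = T 0, T 1, ..., T m = la. *)
Definition is_ssrt (n m : nat) (la mu : intpart)
    (T : {ffun 'I_m.+1 -> intpart}) : Prop :=
  [/\ T ord0 = mu, T ord_max = la
    & forall i : 'I_m,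
        is_hstrip n (T (lift ord0 i)) (T (widen_ord (leqnSn m) i))].

Definition ssrt_spin (n m : nat) (T : {ffun 'I_m.+1 -> intpart}) : nat :=
  (\sum_(i < m) hspin n (T (lift ord0 i)) (T (widen_ord (leqnSn m) i)))%N.

Definition ssrt_weight (n m : nat) (T : {ffun 'I_m.+1 -> intpart}) :
    'X_{1..m} :=
  [multinom hcount n (T (lift ord0 i)) (T (widen_ord (leqnSn m) i)) | i < m].

(* Sums \sum_(i \in A) over a classical set A have the value 0 when infinitely
   many terms are nonzero; finite_ssrt, finite_hstrip and finite_vstrip show
   that the index sets of tableaux and strips are finite. *)
Lemma mem_diagram (la : intpart) (c : nat * nat) :
  (c \in diagram la) = (c.2 < nth 0 la c.1)%N.
Proof.
rewrite /diagram !inE; apply/allpairsPdep/idP => [[i [j [_ + ->]]]|lt_c].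
  by rewrite mem_iota.
exists c.1, c.2; rewrite !mem_iota /= !add0n; split => //; last by case: c lt_c.
by rewrite ltnNge; apply: contraL lt_c => /(nth_default 0%N) ->.
Qed.

Lemma diagram_inj : injective diagram.
Proof.
move=> la mu eq_d; apply: val_inj => /=.
have eq_nth i : nth 0%N la i = nth 0%N mu i.
  have eq_lt j : (j < nth 0 la i)%N = (j < nth 0 mu i)%N.
    by have /= := mem_diagram la (i, j); rewrite eq_d mem_diagram.
  by case: (ltngtP (nth 0%N la i) (nth 0%N mu i)) => // lt_i;
    [have := eq_lt (nth 0%N la i) | have := eq_lt (nth 0%N mu i)];
    rewrite lt_i ltnn.
have szE (nu : intpart) i : (i < size nu)%N = (nth 0%N nu i != 0%N).
  case: ltnP => [lt_i|/(nth_default 0%N) -> //].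
  case: nu lt_i => s /= /andP[_ s0] lt_i.
  by apply/esym; apply: contraNneq s0 => <-; apply: mem_nth.
apply: (@eq_from_nth _ 0%N) => //.
case: (ltngtP (size la) (size mu)) => // lt_sz; [have := szE la (size la) | have := szE mu (size mu)].
  by rewrite ltnn eq_nth -szE lt_sz.
by rewrite ltnn -eq_nth -szE lt_sz.
Qed.

Lemma finite_sub_intpart (D : cells) :
  finite_set [set mu | (diagram mu `<=` D)%fset]%classic.
Proof.
rewrite (_ : [set mu | _]%classic =
  diagram @^-1` [set` fpowerset D])%classic; last first.
  by apply/seteqP; split => mu /=; rewrite fpowersetE.
by apply: finite_preimage (finite_fset _) => x y _ _; apply: diagram_inj.
Qed.

Lemma finite_ssrt (n m : nat) (la mu : intpart) :
  finite_set [set T | @is_ssrt n m la mu T]%classic.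
Proof.
have /finite_fsetP[X XE] := finite_sub_intpart (diagram la).
pose F (g : {ffun 'I_m.+1 -> X}) := [ffun i => val (g i)].
apply: (@sub_finite_set _ _ (range F)); last exact: finite_image.
move=> T [_ Tm Tstrip].
have leT i : T i \in X.
  suff : [set` X]%classic (T i) by [].
  rewrite -XE /=; have [d] := ubnP (m - i)%N; elim: d i => // d IHd i ltid.
  have := ltn_ord i; rewrite ltnS leq_eqVlt => /predU1P[im|lt_im].
    by rewrite (_ : i = ord_max) ?Tm //; apply: val_inj.
  have [sub _] := Tstrip (Ordinal lt_im).
  rewrite (_ : widen_ord _ _ = i) in sub; last exact: val_inj.
  apply: fsubset_trans sub _; apply: IHd.
  by rewrite /= /bump /= add1n subnS; case: (m - i)%N (subn_gt0 i m) ltid => //; rewrite lt_im.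
by exists [ffun i => [` leT i]] => //; apply/ffunP => i; rewrite !ffunE.
Qed.

Lemma finite_skew (N : nat) (la : intpart) :
  finite_set [set mu | (diagram la `<=` diagram mu)%fset /\
                       #|` skew mu la| = N]%classic.
Proof.
pose M := (#|` diagram la| + N)%N.
pose D : cells := [fset c in [seq (i, j) | i <- iota 0 M, j <- iota 0 M]].
apply: sub_finite_set (finite_sub_intpart D) => mu [sub cardN] /=.
have cardM : #|` diagram mu| = M.
  by rewrite /M -cardN /skew -(cardfsID (diagram la)) (fsetIidPr sub).
have leM (f : nat -> nat * nat) b : injective f ->
    (forall i, (i < b)%N -> f i \in diagram mu) -> (b <= M)%N.
  move=> f_inj f_in; rewrite -cardM -(size_iota 0 b) -(size_map f).
  apply: uniq_leq_size; first by rewrite map_inj_uniq ?iota_uniq.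
  by move=> x /mapP[i i_b ->]; apply: f_in; rewrite mem_iota in i_b.
have nth_anti i j : (i <= j)%N -> (nth 0 mu j <= nth 0 mu i)%N.
  move=> le_ij; have [lt_j|/(nth_default 0%N) -> //] := ltnP j (size mu).
  case: mu lt_j {sub cardN cardM leM} => s /= /andP[s_sorted _] lt_j.
  by apply: (sorted_leq_nth (rev_trans leq_trans) leqnn 0%N s_sorted);
     rewrite // inE (leq_ltn_trans le_ij).
apply/fsubsetP => -[i j]; rewrite mem_diagram /= => lt_j.
rewrite /D !inE; apply/allpairsP; exists (i, j); rewrite /= !mem_iota !add0n.
split=> //=.
  apply: (leM (fun l => (l, j))) => [l l' []//|l le_l].
  by rewrite mem_diagram /=; apply: leq_trans lt_j (nth_anti _ _ _).
apply: (leM (pair i)) => [l l' []//|l le_l].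
by rewrite mem_diagram /=; apply: leq_trans lt_j.
Qed.

Lemma card_tiling (n : nat) (S : cells) (P : {fset cells}) :
  is_tiling n S P -> #|` S| = (#|` P| * n)%N.
Proof.
move=> [rib /eqP triv <-]; rewrite -triv big_seq_cond.
rewrite (eq_bigr (fun=> n)) => [|B]; last by rewrite andbT => /rib[].
by rewrite -big_seq_cond big_const_seq iter_addn_0 count_predT mulnC.
Qed.

Lemma transposeK : involutive transpose.
Proof.
move=> S; apply/fsetP => -[i j]; apply/imfsetP/idP => /=.
  by move=> [_ /imfsetP[[a b] /= abS ->] /= [-> ->]].
by move=> ijS; exists (j, i) => //; apply/imfsetP; exists (i, j).
Qed.

Lemma htilingP (n : nat) (mu la : intpart) :
  is_hstrip n mu la -> is_htiling n (skew mu la) (htiling n (skew mu la)).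
Proof. by move=> [_ [P hP]]; rewrite /htiling; case: xgetP => // /(_ P). Qed.

Lemma vtilingP (n : nat) (mu la : intpart) :
  is_vstrip n mu la -> is_vtiling n (skew mu la) (vtiling n (skew mu la)).
Proof. by move=> [_ [P vP]]; rewrite /vtiling; case: xgetP => // /(_ P). Qed.

Lemma finite_hstrip (n k : nat) (la : intpart) :
  finite_set [set mu | is_hstrip n mu la /\ hcount n mu la = k]%classic.
Proof.
apply: sub_finite_set (finite_skew (k * n) la) => mu /= [strip <-].
by split; [case: strip | apply: card_tiling; case: (htilingP strip)].
Qed.

Lemma finite_vstrip (n k : nat) (la : intpart) :
  finite_set [set mu | is_vstrip n mu la /\ vcount n mu la = k]%classic.
Proof.
apply: sub_finite_set (finite_skew (k * n) la) => mu /= [strip <-].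
split; first by case: strip.
have [/card_tiling + _] := vtilingP strip.
have tr_inj : injective transpose := can_inj transposeK.
by rewrite !card_imfset //= => -[a b] [c d] /= [-> ->].
Qed.

Definition removes_ribbon (n : nat) (la nu : intpart) : Prop :=
  diagram nu `<=` diagram la /\ is_ribbon n (skew la nu).

Definition is_core_of (n : nat) (la nu : intpart) : Prop :=
  clos_refl_trans intpart (removes_ribbon n) la nu /\
  ~ exists ka, removes_ribbon n nu ka.

Definition ncore (n : nat) (la : intpart) : intpart :=
  xget la [set nu | is_core_of n la nu]%classic.

(* Symmetric functions in X = (x_1, x_2, ...) are handled through the inverse
   limit description of their ring: a symmetric function is the family, indexed
   by m, of its restrictions x_{m+1} = x_{m+2} = ... = 0 to m variables, and
   identities hold in the ring exactly when they hold for every m. *)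
Definition ribbonG_skew (K : comNzRingType) (q : K) (n m : nat)
    (la mu : intpart) : {mpoly K[m]} :=
  \sum_(T \in [set T | is_ssrt n la mu T]%classic)
     q ^+ ssrt_spin n T *: 'X_[ssrt_weight n T].

Definition ribbonG (K : comNzRingType) (q : K) (n m : nat)
    (la : intpart) : {mpoly K[m]} :=
  ribbonG_skew q n m la (ncore n la).

(* The outer polynomial variable is the variable t of the generating function. *)
Definition bold_e (K : comNzRingType) (q : K) (n m : nat) (k : nat) :
    {mpoly K[m]} :=
  (\prod_(i < m) \prod_(j < n) (1 + (q ^+ (2 * j) *: 'X_i)%:P * 'X))`_k.

(* Each factor 1 / (1 - x_i q^(2j) t) is expanded as a geometric series
   truncated after degree k in t, which leaves the coefficient of t^k
   unchanged; bold_h_gen is the generating function identity. *)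
Definition bold_h (K : comNzRingType) (q : K) (n m : nat) (k : nat) :
    {mpoly K[m]} :=
  (\prod_(i < m) \prod_(j < n)
     \sum_(l < k.+1) ((q ^+ (2 * j) *: 'X_i)%:P * 'X) ^+ l)`_k.

Lemma bold_h_gen (K : comNzRingType) (q : K) (n m d : nat) :
  \sum_(i < d.+1) bold_h q n m i *
      (\prod_(i < m) \prod_(j < n) (1 - (q ^+ (2 * j) *: 'X_i)%:P * 'X))`_(d - i)
  = (d == 0%N)%:R.
Proof.
pose a (i : 'I_m) (j : 'I_n) : {mpoly K[m]} := q ^+ (2 * j) *: 'X_i.
pose cong N (p r : {poly {mpoly K[m]}}) := exists s, p = r + s * 'X^N.
have congM N p p' r r' : cong N p r -> cong N p' r' -> cong N (p * p') (r * r').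
  move=> [s ->] [s' ->]; exists (r * s' + s * r' + s * s' * 'X^N).
  by ring.
have cong_prod N (F E : 'I_m -> 'I_n -> {poly {mpoly K[m]}}) :
    (forall i j, cong N (F i j) (E i j)) ->
  cong N (\prod_(i < m) \prod_(j < n) F i j) (\prod_(i < m) \prod_(j < n) E i j).
  have cong1 : cong N 1 1 by exists 0; rewrite mul0r addr0.
  move=> congF; elim/big_ind2: _ => // [*|i _]; first exact: congM.
  by elim/big_ind2: _ => // *; apply: congM.
have cong_coef N p r i : (i < N)%N -> cong N p r -> p`_i = r`_i.
  by move=> ltiN [s ->]; rewrite coefD coefMXn ltiN addr0.
pose geo N := \prod_(i < m) \prod_(j < n) \sum_(l < N) ((a i j)%:P * 'X) ^+ l.
have hE i : (i < d.+1)%N -> bold_h q n m i = (geo d.+1)`_i.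
  move=> lt_i; apply/esym/(cong_coef i.+1) => //; apply: cong_prod => k l.
  rewrite -(subnKC lt_i) big_split_ord /=.
  exists (\sum_(t < (d.+1 - i.+1)) ((a k l)%:P * 'X) ^+ t * (a k l)%:P ^+ i.+1).
  congr (_ + _); rewrite mulr_suml; apply: eq_bigr => t _.
  by rewrite exprD mulrC -mulrA -exprMn.
rewrite (eq_bigr (fun i : 'I_d.+1 => (geo d.+1)`_i *
  (\prod_(i < m) \prod_(j < n) (1 - (a i j)%:P * 'X))`_(d - i))); last first.
  by move=> i _; rewrite hE.
rewrite -coefM -coef1 /geo -big_split /=.
under eq_bigr do rewrite -big_split /=.
apply: (cong_coef d.+1) => //.
rewrite [X in cong _ _ X](_ : 1 = \prod_(i < m) \prod_(j < n) 1); last first.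
  by rewrite big1 // => i _; rewrite big1.
apply: cong_prod => i j; exists (- (a i j)%:P ^+ d.+1).
by rewrite mulrC -opprB mulNr -subrX1 opprB mulNr -exprMn.
Qed.

(* The field C(q), for C = R[i] with R the real numbers, and its generator. *)
Definition Cq (R : realType) : fieldType := {fraction {poly R[i]}}.

Definition Cq_gen (R : realType) : Cq R := tofrac ('X : {poly R[i]}).

(* Main.v *)
(* Encode a partition by its bead configuration on the integers, the set of
   vertical steps of its boundary.  Adding an n-ribbon moves a bead from p to
   p + n, with spin the number of beads strictly in between; a horizontal
   (vertical) ribbon strip is a sequence of such moves with increasing
   (decreasing) p.  Hence the operators that add a vertical strip and remove a
   horizontal one are ordered products of elementary factors 1 + y u_p and
   1 + x d_p.  The factors with different p commute, and those with equal p
   commute up to the diagonal operators gam(c_p), where c_p counts the beads in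
   [p, p + n) and gam(c) = prod_(j < c) (1 + xy q^(2j)).  These corrections
   telescope from c = n (far left, all beads) to c = 0 (far right, no bead), so
   that exchanging the two products costs exactly prod_(j < n) (1 + xy q^(2j)).
   Since the ribbon function in m variables comes from m successive removals of
   horizontal strips down to the core, from which no ribbon can be removed, the
   e-rule follows by induction on m.  The h-rule follows from the e-rule because
   the generating series of the two families of strip-adding operators, like
   those of e and h, are inverse to each other up to a sign of the variable. *)
Require Import Defs.
From mathcomp Require Import all_boot all_order all_algebra.
From mathcomp Require Import finmap complex.
From mathcomp Require Import boolp classical_sets fsbigop reals.
From mathcomp Require Import mpoly.
From mathcomp Require Import functions cardinality zify ring.
From Stdlib Require Import Relation_Operators Operators_Properties.

Set Implicit Arguments.
Unset Strict Implicit.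
Unset Printing Implicit Defensive.

Import Order.TTheory GRing.Theory Num.Theory.
Local Open Scope ring_scope.

(** * Bead configurations *)

(** A vertical strip adds ribbons with decreasing tails, and a horizontal strip, read backwards,
    also removes them with decreasing tails. The two ordered products therefore run through the
    sites in the same direction and can be exchanged factor by factor. Horizontal addition and
    horizontal removal run in opposite directions, which is why the e-rule comes first and the
    h-rule is deduced from it. The powers [q ^+ (2 * j)] have a local origin: moving a bead up and
    back over c others costs [q ^+ c] twice, and 1 + xy q^(2c) is exactly the factor from gam(c) to
    gam(c + 1). The infinite products have to be cut to a finite range of sites. For a diagram with
    at most N cells all sites up to -N are filled and all sites beyond N are empty, so a range
    depending on N suffices. Since the operators act on functions of arbitrary states, the function
    they start from is made to vanish on states that do not come from such diagrams; otherwise the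
    leftmost window need not be full. *)

Definition maya := int -> bool.

Fixpoint descend (a : int) (l : nat) : seq int :=
  if l is l'.+1 then a + l'%:Z :: descend a l' else [::].

Lemma mem_descend a l (x : int) : (x \in descend a l) = (a <= x < a + l%:Z).
Proof.
elim: l => [|l IHl] /=; first by rewrite in_nil; lia.
by rewrite inE IHl; case: eqVneq; lia.
Qed.

Lemma sorted_descend a l : sorted >%R (descend a l).
Proof.
case: l => //= l; elim: l => //= l IHl; rewrite IHl andbT; lia.
Qed.

Fixpoint subs (ps : seq int) : seq (seq int) :=
  if ps is p :: ps' then [seq p :: t | t <- subs ps'] ++ subs ps'
  else [:: [::]].

Lemma mem_subs ps t : (t \in subs ps) = subseq t ps.
Proof.
elim: ps t => [|p ps IHps] t /=; first by rewrite inE; case: t.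
rewrite mem_cat IHps; case: t => [|x t] /=; first by rewrite sub0seq orbT.
case: eqVneq => [->|neq].
  rewrite mem_map ?IHps => [|u v [->]] //.
  apply/orb_idr => /(subseq_trans _) -> //; exact: subseq_cons.
rewrite (_ : (_ \in _) = false) //; apply/negbTE/mapP => -[u _ [eq _]].
by rewrite eq eqxx in neq.
Qed.

Lemma uniq_subs ps : uniq ps -> uniq (subs ps).
Proof.
elim: ps => //= p ps IHps /andP[pps /IHps ups].
rewrite cat_uniq ups map_inj_uniq ?ups => [|u v [->]] //=; rewrite andbT.
apply/hasPn => t; rewrite mem_subs => tps; apply/mapP => -[u _ t_eq].
by move: (mem_subseq tps); rewrite t_eq => /(_ p);
  rewrite inE eqxx (negbTE pps) => /(_ isT).
Qed.

Section Maya.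
Variable n : nat.
Implicit Types (s : maya) (p x : int) (t ps : seq int).

Definition up p s : maya :=
  fun x => if x == p then false else if x == p + n%:Z then true else s x.
Definition down p s : maya :=
  fun x => if x == p then true else if x == p + n%:Z then false else s x.
Definition can_up p s := s p && ~~ s (p + n%:Z).
Definition can_down p s := ~~ s p && s (p + n%:Z).

Definition between p s : nat := (\sum_(1 <= j < n) s (p + j%:Z)%R)%N.
Definition window p s : nat := (\sum_(0 <= j < n) s (p + j%:Z)%R)%N.

Fixpoint moves (act : int -> maya -> maya) t s : maya :=
  if t is p :: t' then moves act t' (act p s) else s.
Fixpoint can_moves (can : int -> maya -> bool) act t s : bool :=
  if t is p :: t' then can p s && can_moves can act t' (act p s) else true.
Fixpoint moves_spin act t s : nat :=
  if t is p :: t' then (between p s + moves_spin act t' (act p s))%N else 0%N.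

Lemma between_near p p' s s' :
  (forall j, (0 < j < n)%N -> s (p + j%:Z) = s' (p' + j%:Z)) ->
  between p s = between p' s'.
Proof. by move=> eq_s; apply: eq_big_nat => j ltj; rewrite eq_s. Qed.

Hypothesis n_gt0 : (0 < n)%N.

Lemma window_between p s : window p s = (s p + between p s)%N.
Proof. by rewrite /window big_ltn // addr0. Qed.

Lemma window_next p s : window (p + 1) s = (between p s + s (p + n%:Z)%R)%N.
Proof.
rewrite /window /between -(prednK n_gt0) big_nat_recr //= [in RHS]big_add1 /=.
congr (_ + _)%N; last by congr (nat_of_bool (s _)); lia.
by apply: eq_bigr => j _; congr (nat_of_bool (s _)); lia.
Qed.

Lemma between_up p s : between p (up p s) = between p s.
Proof. by apply: between_near => j ltj; rewrite /up !ifF //; lia. Qed.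

Lemma between_down p s : between p (down p s) = between p s.
Proof. by apply: between_near => j ltj; rewrite /down !ifF //; lia. Qed.

Lemma upK p s : can_up p s -> down p (up p s) = s.
Proof.
move=> /andP[sp spn]; apply/funext => x; rewrite /down /up.
by case: eqVneq => [->|_] //; case: eqVneq => [->|_] //; apply/esym/negbTE.
Qed.

Lemma downK p s : can_down p s -> up p (down p s) = s.
Proof.
move=> /andP[sp spn]; apply/funext => x; rewrite /down /up.
by case: eqVneq => [->|_] //; [apply/esym/negbTE|case: eqVneq => [->|_]].
Qed.

Lemma can_down_up p s : can_up p s -> can_down p (up p s).
Proof. by move=> _; rewrite /can_down /up eqxx ifF ?eqxx //; lia. Qed.

Lemma can_up_down p s : can_down p s -> can_up p (down p s).
Proof. by move=> _; rewrite /can_up /down eqxx ifF ?eqxx //; lia. Qed.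

Lemma sum_eq_shift p x :
  (\sum_(1 <= j < n) ((p + j%:Z)%R == x) = (p < x < p + n%:Z)%R)%N.
Proof.
elim: (n) => [|[|k] IHk]; try by rewrite big_geq //; lia.
rewrite big_nat_recr //= IHk; by case: (eqVneq (p + k.+1%:Z) x); lia.
Qed.

(** The bead leaves [x] and lands on [x + n], so only these two sites can change the count. The
    additive form avoids truncated subtraction. *)
Lemma between_up_neq p x s : can_up x s ->
  (between p (up x s) + (p < x < p + n%:Z)%R =
   between p s + (p < x + n%:Z < p + n%:Z)%R)%N.
Proof.
move=> /andP[sx sxn]; rewrite -!sum_eq_shift -!big_split;
  apply: eq_bigr => j _ /=.
rewrite /up; have [->|neq] := eqVneq (p + j%:Z) x.
  by rewrite sx (_ : (x == x + n%:Z) = false) //; lia.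
by have [->|] := eqVneq (p + j%:Z) (x + n%:Z); rewrite ?(negbTE sxn).
Qed.

Lemma moves_cat act t1 t2 s :
  moves act (t1 ++ t2) s = moves act t2 (moves act t1 s).
Proof. by elim: t1 s => //= p t1 IHt s. Qed.

Lemma can_moves_cat can act t1 t2 s : can_moves can act (t1 ++ t2) s =
  can_moves can act t1 s && can_moves can act t2 (moves act t1 s).
Proof. by elim: t1 s => //= p t1 IHt s; rewrite IHt andbA. Qed.

Lemma moves_spin_cat act t1 t2 s : moves_spin act (t1 ++ t2) s =
  (moves_spin act t1 s + moves_spin act t2 (moves act t1 s))%N.
Proof. by elim: t1 s => //= p t1 IHt s; rewrite IHt addnA. Qed.

Lemma moves_rev (can can' : int -> maya -> bool) act act' :
    (forall p s, can p s -> [/\ can' p (act p s), act' p (act p s) = s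
                             & between p (act p s) = between p s]) ->
  forall t s, can_moves can act t s ->
  [/\ can_moves can' act' (rev t) (moves act t s),
      moves act' (rev t) (moves act t s) = s
    & moves_spin act' (rev t) (moves act t s) = moves_spin act t s].
Proof.
move=> inv; elim=> //= p t IHt s /andP[cp /IHt[ct mt st]].
have [cp' ap' bp'] := inv _ _ cp.
rewrite rev_cons -cats1 can_moves_cat moves_cat moves_spin_cat mt ct st /=.
by rewrite cp' ap' bp' addn0 addnC.
Qed.

Lemma moves_up_rev t s : can_moves can_up up t s ->
  [/\ can_moves can_down down (rev t) (moves up t s),
      moves down (rev t) (moves up t s) = s
    & moves_spin down (rev t) (moves up t s) = moves_spin up t s].
Proof.
apply: moves_rev => {t}p {}s cu.
by rewrite can_down_up // upK // between_up.
Qed.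

Lemma moves_down_rev t s : can_moves can_down down t s ->
  [/\ can_moves can_up up (rev t) (moves down t s),
      moves up (rev t) (moves down t s) = s
    & moves_spin up (rev t) (moves down t s) = moves_spin down t s].
Proof.
apply: moves_rev => {t}p {}s cd.
by rewrite can_up_down // downK // between_down.
Qed.

Lemma moves_up_fixed x t s :
  all (fun p => (x != p) && (x != p + n%:Z)) t -> moves up t s x = s x.
Proof.
elim: t s => //= p t IHt s /andP[/andP[nxp nxpn] /IHt ->].
by rewrite /up (negbTE nxp) (negbTE nxpn).
Qed.

(* The first bead to move is the leftmost one at which the two states differ. *)
Lemma moves_up_increasing_inj t t' s :
    sorted <%R t -> sorted <%R t' ->
    can_moves can_up up t s -> can_moves can_up up t' s ->
  moves up t s = moves up t' s -> t = t'.
Proof.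
have first p t0 s0 : path <%R p t0 -> can_up p s0 ->
    moves up t0 (up p s0) p = false.
  move=> /(order_path_min lt_trans) lt_t _; rewrite moves_up_fixed.
    by rewrite /up eqxx.
  by apply: sub_all lt_t => z; lia.
have other z p t0 s0 : z < p -> path <%R p t0 -> moves up t0 (up p s0) z = s0 z.
  move=> ltzp /(order_path_min lt_trans) lt_t; rewrite moves_up_fixed.
    by rewrite /up !ifF //; lia.
  by apply: sub_all lt_t => w; lia.
elim: t t' s => [|p t IHt] [|p' t'] s //=.
- move=> _ pt' _ /andP[cp' _] eq_s; have := first _ _ _ pt' cp'.
  by rewrite -eq_s; case/andP: cp' => ->.
- move=> pt _ /andP[cp _] _ eq_s; have := first _ _ _ pt cp.
  by rewrite eq_s; case/andP: cp => ->.
move=> pt pt' /andP[cp ct] /andP[cp' ct'] eq_s.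
case: (ltgtP p p') => [ltp|ltp|eqp].
- have := first _ _ _ pt cp; rewrite eq_s other //.
  by case/andP: cp => ->.
- have := first _ _ _ pt' cp'; rewrite -eq_s other //.
  by case/andP: cp' => ->.
rewrite -eqp in pt' cp' ct' eq_s *; congr (_ :: _).
exact: IHt (path_sorted pt) (path_sorted pt') ct ct' eq_s.
Qed.

(** When moves decrease, the landing site [p + n] of the first one is never touched again, and no
    site to its right changes; so the rightmost difference between the two states reveals the first
    move. *)
Lemma moves_up_decreasing_inj t t' s :
    sorted >%R t -> sorted >%R t' ->
    can_moves can_up up t s -> can_moves can_up up t' s ->
  moves up t s = moves up t' s -> t = t'.
Proof.
have gt_tr : transitive (>%R : rel int) by move=> x y z; lia.
have first p t0 s0 : path >%R p t0 -> can_up p s0 ->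
    moves up t0 (up p s0) (p + n%:Z) = true.
  move=> /(order_path_min gt_tr) lt_t _; rewrite moves_up_fixed.
    by rewrite /up eqxx ifF //; lia.
  by apply: sub_all lt_t => z /=; lia.
have other z p t0 s0 : p < z -> path >%R p t0 ->
    moves up t0 (up p s0) (z + n%:Z) = s0 (z + n%:Z).
  move=> ltzp /(order_path_min gt_tr) lt_t; rewrite moves_up_fixed.
    by rewrite /up !ifF //; lia.
  by apply: sub_all lt_t => w /=; lia.
elim: t t' s => [|p t IHt] [|p' t'] s //=.
- move=> _ pt' _ /andP[cp' _] eq_s; have := first _ _ _ pt' cp'.
  by rewrite -eq_s; case/andP: cp' => _ /negbTE ->.
- move=> pt _ /andP[cp _] _ eq_s; have := first _ _ _ pt cp.
  by rewrite eq_s; case/andP: cp => _ /negbTE ->.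
move=> pt pt' /andP[cp ct] /andP[cp' ct'] eq_s.
case: (ltgtP p p') => [ltp|ltp|eqp].
- have := first _ _ _ pt' cp'; rewrite -eq_s other //.
  by case/andP: cp' => _ /negbTE ->.
- have := first _ _ _ pt cp; rewrite eq_s other //.
  by case/andP: cp => _ /negbTE ->.
rewrite -eqp in pt' cp' ct' eq_s *; congr (_ :: _).
exact: IHt (path_sorted pt) (path_sorted pt') ct ct' eq_s.
Qed.

(** * Elementary operators that add or remove one ribbon *)

Section Operators.
Variables (B : comNzRingType) (q : B).
Implicit Types (phi : maya -> B).

Definition op (can : int -> maya -> bool) act (y : B) p phi : maya -> B :=
  fun s => phi s + (if can p s then y * q ^+ between p s *
    phi (act p s) else 0).

(** Operators on functions compose contravariantly: the head of [ps] is the move made first on the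
    state. *)
Definition ops can act y ps phi : maya -> B := foldr (op can act y) phi ps.

Definition addop := op can_up up.
Definition remop := op can_down down.
Definition addops := ops can_up up.
Definition remops := ops can_down down.

Definition gam (z : B) (c : nat) : B := \prod_(j < c) (1 + z * q ^+ (2 * j)).

Definition gamop z p phi : maya -> B := fun s => gam z (window p s) * phi s.

Lemma gamS z c : gam z c.+1 = gam z c * (1 + z * (q ^+ c * q ^+ c)).
Proof. by rewrite /gam big_ord_recr /= mul2n -addnn exprD. Qed.

(** If exactly one of [p], [p + n] is filled and c beads lie between them, then moving the bead and
    moving it back contributes x y q^(2c) on the side where this is possible, while the windows at
    [p] and [p + 1] differ by one; the recursion [gamS] balances both effects. If both sites are
    filled or both empty, nothing moves and the windows agree. *)
Lemma addop_remop_same (x y : B) p phi :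
  gamop (x * y) (p + 1) (addop y p (remop x p phi)) =
  remop x p (addop y p (gamop (x * y) p phi)).
Proof.
apply/funext => s; rewrite /gamop window_next /addop /remop /op.
have [sp|nsp] := boolP (s p); have [spn|nspn] := boolP (s (p + n%:Z)).
- by rewrite /can_up /can_down sp spn /= !addr0 window_between sp addnC.
- have can : can_up p s by rewrite /can_up sp nspn.
  have cd : can_down p s = false by rewrite /can_down sp.
  rewrite can cd can_down_up // between_up upK // !addr0.
  rewrite !window_between sp between_up /up eqxx add1n add0n addn0.
  by rewrite gamS; ring.
- have can : can_down p s by rewrite /can_down nsp spn.
  have cu : can_up p s = false by rewrite /can_up (negbTE nsp).
  rewrite can cu can_up_down // between_down downK // !addr0.
  rewrite !window_between (negbTE nsp) between_down /down eqxx.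
  by rewrite addn1 add0n add1n gamS; ring.
- by rewrite /can_up /can_down (negbTE nsp) (negbTE nspn) /= !addr0
  window_between
    (negbTE nsp) addnC.
Qed.

(* If [i] and [j] differ by less than [n], the bead moved by one operator lies
   between the two positions of the other, before or after both moves alike. *)
Lemma addop_remop_comm (x y : B) i j phi : i != j ->
  addop y i (remop x j phi) = remop x j (addop y i phi).
Proof.
move=> neq_ij; apply/funext => s; rewrite /addop /remop /op.
have crossE : can_up i s && can_down j (up i s) ->
    [/\ can_down j s, can_up i (down j s), down j (up i s) = up i (down j s)
      & (between i s + between j (up i s) =
         between j s + between i (down j s))%N].
  move=> /andP[cui cdj].
  (* If [i = j + n], the up move has just vacated the site where the down move needs a bead; if
     [j = i + n], it has just filled the site that must be empty. *)
  have [nij nji] : i != j + n%:Z /\ j != i + n%:Z.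
    split; apply: contraTneq cdj => eq_ij.
      by rewrite /can_down /up -eq_ij eqxx andbF.
    by rewrite /can_down /up eq_ij eqxx ifF //; lia.
  have cdj' : can_down j s.
    by move: cdj; rewrite /can_down /up !ifF //; lia.
  split=> //.
  - by move: cui; rewrite /can_up /down !ifF //; lia.
  - apply/funext => z; rewrite /up /down.
    by case: (eqVneq z i); case: (eqVneq z j); case: (eqVneq z (i + n%:Z));
      case: (eqVneq z (j + n%:Z)) => //; lia.
  have := between_up_neq j cui.
  have := between_up_neq i (can_up_down cdj').
  rewrite downK //; lia.
have crossE' : can_down j s && can_up i (down j s) ->
  can_up i s && can_down j (up i s).
  move=> /andP[cdj cui].
  have [nij nji] : i != j + n%:Z /\ j != i + n%:Z.
    split; apply: contraTneq cui => eq_ij.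
      by rewrite /can_up /down eq_ij eqxx ifF //; lia.
    by rewrite /can_up /down -eq_ij eqxx andbF.
  rewrite /can_up /can_down /up !ifF //; try lia.
  by move: cdj cui; rewrite /can_up /can_down /down !ifF //; lia.
case cui: (can_up i s) crossE crossE' => /=; case cdj: (can_down j s) => //=.
all: case cdj': (can_down j (up i s)); case cui': (can_up i (down j s)) => //=.
all: try by move=> _ /(_ isT).
all: try by case/(_ isT).
all: rewrite ?addr0 //; try by move=> *; ring.
move=> /(_ isT) [_ _ -> eq_btw] _; rewrite !mulrDr !mulrA.
have -> : y * q ^+ between i s * x * q ^+ between j (up i s) =
  x * q ^+ between j s * y * q ^+ between i (down j s).
  transitivity (x * y * q ^+ (between i s + between j (up i s))).
    by rewrite exprD; ring.
  by rewrite eq_btw exprD; ring.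
ring.
Qed.

(** The operator u_p has square zero: after the move the site [p] is empty. *)
Lemma addop_cancel (y : B) p phi : addop (- y) p (addop y p phi) = phi.
Proof.
apply/funext => s; rewrite /addop /op.
case: ifP => [cu|_]; last by rewrite !addr0.
by rewrite [can_up p (up p s)]/can_up /up eqxx /= addr0; ring.
Qed.

Lemma ops_sum can act (y : B) ps phi s :
  ops can act y ps phi s = \sum_(t <- subs ps | can_moves can act t s)
    y ^+ size t * q ^+ moves_spin act t s * phi (moves act t s).
Proof.
elim: ps s => [|p ps IHps] s /=;
  first by rewrite big_cons big_nil /= !expr0 !mul1r addr0.
rewrite big_cat big_map /= -IHps addrC /= /op -/(ops _ _ _ _ _); congr (_ + _).
case: (can p s) => /=; last by rewrite big_pred0.
rewrite IHps mulr_sumr; apply: eq_bigr => t _; rewrite exprS exprD; ring.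
Qed.

Lemma addops_cons y p ps phi :
  addops y (p :: ps) phi = addop y p (addops y ps phi).
Proof. by []. Qed.

Lemma remops_cons (x : B) p ps phi :
  remops x (p :: ps) phi = remop x p (remops x ps phi).
Proof. by []. Qed.

Lemma addops_rcons y p ps phi :
  addops y (rcons ps p) phi = addops y ps (addop y p phi).
Proof. exact: foldr_rcons. Qed.

Lemma addops_remop_comm (x y : B) ps p phi : p \notin ps ->
  addops y ps (remop x p phi) = remop x p (addops y ps phi).
Proof.
elim: ps => [//|i ps IHps]; rewrite inE negb_or => /andP[neq /IHps].
by rewrite !addops_cons => ->; rewrite addop_remop_comm // eq_sym.
Qed.

Lemma addop_remops_comm (x y : B) ps p phi : p \notin ps ->
  addop y p (remops x ps phi) = remops x ps (addop y p phi).
Proof.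
elim: ps => [//|i ps IHps]; rewrite inE negb_or => /andP[neq /IHps].
by rewrite !remops_cons => <-; rewrite addop_remop_comm.
Qed.

Lemma addops_remops (x y : B) a l phi :
  gamop (x * y) (a + l%:Z) (addops y (descend a l) (remops x (descend a l) phi))
    =
  remops x (descend a l) (addops y (descend a l) (gamop (x * y) a phi)).
Proof.
have notin k : a + k%:Z \notin descend a k by rewrite mem_descend; lia.
elim: l => [|l IHl]; first by rewrite addr0.
rewrite [descend _ _]/= !addops_cons !remops_cons addops_remop_comm //.
rewrite (_ : a + l.+1%:Z = a + l%:Z + 1); last by lia.
by rewrite addop_remop_same IHl addop_remops_comm.
Qed.

(** The factors cancel from the inside out, which forces the reversed order: with [ps] decreasing,
    one product adds vertical strips and the other horizontal ones. *)
Lemma addops_cancel (y : B) ps phi :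
  addops (- y) ps (addops y (rev ps) phi) = phi.
Proof.
elim: ps phi => [//|p ps IHps] phi.
by rewrite rev_cons addops_rcons addops_cons IHps addop_cancel.
Qed.

End Operators.
Lemma ops_scale (B : comNzRingType) (q : B) can act (y c : B) ps phi s :
  ops q can act y ps (fun s => c * phi s) s = c * ops q can act y ps phi s.
Proof.
by rewrite !ops_sum mulr_sumr; apply: eq_bigr => t _; rewrite mulrCA.
Qed.

(** * Coefficients of the ordered products *)

Section Coefficients.
Variables (A : comNzRingType) (q : A).

Definition ops_coef can act ps k (psi : maya -> A) s : A :=
  \sum_(t <- subs ps | can_moves can act t s && (size t == k))
    q ^+ moves_spin act t s * psi (moves act t s).

(** [Phi] may itself depend on ['X], whence the convolution; this is what composing two products in
    the same variable requires. *)
Lemma coef_ops_scaleX can act (c : A) ps (Phi : maya -> {poly A}) s k :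
  (ops q%:P can act (c%:P * 'X) ps Phi s)`_k =
  \sum_(i < k.+1)
    c ^+ i * ops_coef can act ps i (fun s => (Phi s)`_(k - i)) s.
Proof.
rewrite ops_sum coef_sum.
under [RHS]eq_bigr => i _ do rewrite /ops_coef mulr_sumr big_mkcondr.
rewrite exchange_big; apply: eq_bigr => t _ /=.
have -> : (c%:P * 'X) ^+ size t * q%:P ^+ moves_spin act t s *
  Phi (moves act t s)
    = (c ^+ size t * q ^+ moves_spin act t s)%:P * (Phi (moves act t s) *
      'X^(size t)).
  by rewrite exprMn rmorphM !rmorphXn /=; ring.
rewrite coefCM coefMXn -big_mkcond /=.
pose F i := c ^+ i * (q ^+ moves_spin act t s * (Phi (moves act t s))`_(k - i)).
under [RHS]eq_bigl => i do rewrite eq_sym.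
rewrite (big_ord1_eq _ F) ltnS [in RHS]leqNgt /F.
by case: ltnP => _ /=; ring.
Qed.

Lemma coef_ops_const can act (x : A) ps (Phi : maya -> {poly A}) s k :
  (ops q%:P can act x%:P ps Phi s)`_k =
  ops q can act x ps (fun s => (Phi s)`_k) s.
Proof.
rewrite !ops_sum coef_sum; apply: eq_bigr => t _.
by rewrite -!rmorphXn -rmorphM coefCM.
Qed.

Lemma coef_opsX can act ps (psi : maya -> A) s k :
  (ops q%:P can act 'X ps (fun s => (psi s)%:P) s)`_k =
  ops_coef can act ps k psi s.
Proof.
have := coef_ops_scaleX can act 1 ps (fun s => (psi s)%:P) s k.
rewrite mul1r => ->; rewrite big_ord_recr /= expr1n mul1r subnn big1 ?add0r.
  by apply: eq_bigr => t _; rewrite coefC.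
move=> i _; rewrite /ops_coef big1 ?mulr0 // => t _.
by rewrite coefC subn_eq0 leqNgt ltn_ord mulr0.
Qed.

(** This is the coefficient of ['X ^+ k] in [addops_remops], with ['X] marking additions and the
    constant [x] marking removals. An empty window on the right turns one correction into an empty
    product; full windows on the support of [psi] turn the other into a scalar, which can be pulled
    out of all operators. *)
Lemma ops_coef_remops (x : A) a l (psi : maya -> A) s k :
    window (a + l%:Z) s = 0%N ->
    (forall s, psi s != 0 -> window a s = n) ->
  ops_coef can_up up (descend a l) k (remops q x (descend a l) psi) s =
  \sum_(i < k.+1) (gam q%:P (x%:P * 'X) n)`_i *
    remops q x (descend a l) (ops_coef can_up up (descend a l) (k - i)%N psi) s.
Proof.
move=> top bottom; set ps := descend a l.
have := addops_remops q%:P x%:P 'X a l (fun s => (psi s)%:P).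
move/(congr1 (fun f : maya -> {poly A} => (f s)`_k));
  rewrite {1}/gamop top /gam big_ord0 mul1r.
rewrite -/(gam q%:P _ n).
have -> : gamop q%:P (x%:P * 'X) a (fun s => (psi s)%:P) =
          fun s => gam q%:P (x%:P * 'X) n * (psi s)%:P.
  apply/funext => s0; rewrite /gamop;
    have [->|/bottom ->//] := eqVneq (psi s0) 0.
  by rewrite !mulr0.
have -> : addops q%:P 'X ps (fun s => gam q%:P (x%:P * 'X) n * (psi s)%:P) =
   fun s => gam q%:P (x%:P * 'X) n * addops q%:P 'X ps (fun s => (psi s)%:P) s.
  by apply/funext => s0; exact: ops_scale.
rewrite /remops ops_scale coefM => eqk.
rewrite -coef_opsX; under eq_bigr => i _.
  rewrite (_ : ops_coef _ _ _ _ _ =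
    fun s => (addops q%:P 'X ps (fun s => (psi s)%:P) s)`_(k - i)); last first.
    by apply/funext => s0; rewrite /addops coef_opsX.
  rewrite -coef_ops_const.
  over.
rewrite -eqk /addops; suff -> : ops q%:P can_down down x%:P ps
    (fun s => (psi s)%:P) = fun s => (ops q can_down down x ps psi s)%:P by [].
apply/funext => s0; apply/polyP => j; rewrite coef_ops_const coefC.
under [X in ops _ _ _ _ _ X]funext => s1 do rewrite coefC.
case: eqP => // _.
by rewrite ops_sum big1 // => t _; rewrite mulr0.
Qed.

Lemma ops_coef_cancel ps (psi : maya -> A) s k : (0 < k)%N ->
  \sum_(i < k.+1) (-1) ^+ i *
    ops_coef can_up up ps i (ops_coef can_up up (rev ps) (k - i)%N psi) s = 0.
Proof.
move=> k_gt0; have := addops_cancel q%:P 'X ps (fun s => (psi s)%:P).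
move/(congr1 (fun f : maya -> {poly A} => (f s)`_k));
  rewrite coefC gtn_eqF // => eq0.
rewrite -[RHS]eq0 /addops.
rewrite (_ : - 'X = (-1)%:P * 'X); last by rewrite polyCN mulN1r.
rewrite coef_ops_scaleX; apply: eq_bigr => i _; congr (_ * _).
by apply: eq_bigr => t _; rewrite coef_opsX.
Qed.

End Coefficients.
End Maya.

Local Open Scope fset_scope.
Local Open Scope ring_scope.

(** * Profiles of Young diagrams *)

Definition cont (c : nat * nat) : int := c.2%:Z - c.1%:Z.

Definition downset (L : cells) : Prop :=
  forall c d : nat * nat, c \in L -> (d.1 <= c.1)%N -> (d.2 <= c.2)%N ->
    d \in L.

Definition diag_card (L : cells) (x : int) : nat :=
  #|` [fset c in L | cont c == x]|.

(* In the Russian convention the boundary of L is the graph of [prof L]; the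
   vertical steps of the boundary, marked by [bead], are its descents. *)
Definition prof (L : cells) (x : int) : nat := (`|x| + 2 * diag_card L x)%N.

Definition bead (L : cells) : maya := fun x => (prof L x < prof L (x - 1))%N.

Definition diag_cell (x : int) (t : nat) : nat * nat :=
  if 0 <= x then (t, (t + `|x|)%N) else ((t + `|x|)%N, t).

Lemma cont_diag_cell x t : cont (diag_cell x t) = x.
Proof. by rewrite /cont /diag_cell; case: ifP => /=; lia. Qed.

Lemma sum_diag_cell x t :
  ((diag_cell x t).1 + (diag_cell x t).2 = `|x| + 2 * t)%N.
Proof. by rewrite /diag_cell; case: ifP => /=; lia. Qed.

Lemma diag_cellK c : diag_cell (cont c) (minn c.1 c.2) = c.
Proof.
by case: c => i j; rewrite /cont /diag_cell /=; case: ifP => /= h; congr pair;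
  lia.
Qed.

Lemma cell_eq (c d : nat * nat) :
  cont c = cont d -> (c.1 + c.2 = d.1 + d.2)%N -> c = d.
Proof.
by case: c d => [i j] [i' j']; rewrite /cont /= => h1 h2; congr pair; lia.
Qed.

Lemma downset_diagram la : downset (diagram la).
Proof.
move=> [i j] [i' j'] /=; rewrite !mem_diagram /= => ltj lei lej.
apply: leq_ltn_trans lej (leq_trans ltj _).
have [lt_i|/(nth_default 0%N) -> //] := ltnP i (size la).
case: la lt_i {ltj} => s /= /andP[s_sorted _] lt_i.
by apply: (sorted_leq_nth (rev_trans leq_trans) leqnn 0%N s_sorted);
   rewrite // inE (leq_ltn_trans lei).
Qed.

Lemma initial_segment (L : cells) (g : nat -> nat * nat) : injective g ->
    (forall t t', (t' <= t)%N -> g t \in L -> g t' \in L) ->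
  exists m, forall t, (g t \in L) = (t < m)%N.
Proof.
move=> g_inj mono; have exN : exists t, g t \notin L.
  exists #|` L|; apply/negP => gL; suff : (#|` L| < #|` L|)%N by rewrite ltnn.
  rewrite -[X in (X <= _)%N](size_iota 0 #|` L|.+1) -(size_map g).
  apply: uniq_leq_size => [|x /mapP[i + ->]];
    first by rewrite map_inj_uniq ?iota_uniq.
  by rewrite mem_iota => lti; apply: mono gL.
case: (ex_minnP exN) => m mN minm; exists m => t; apply/idP/idP => [|ltm].
  by apply: contraLR; rewrite -leqNgt => le_mt; apply: contra mN; apply: mono.
by apply: contraLR ltm => /minm; rewrite leqNgt.
Qed.

Lemma diag_cardP L : downset L ->
  forall x t, (diag_cell x t \in L) = (t < diag_card L x)%N.
Proof.
move=> dL x; have g_inj : injective (diag_cell x).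
  by move=> u v; rewrite /diag_cell; case: ifP => _ [] //; lia.
have [|m inP] := @initial_segment L _ g_inj.
  by move=> t t' le_t /dL; apply; rewrite /diag_cell; case: ifP => /=; lia.
move=> t; rewrite inP; congr (_ < _)%N.
have -> : m = #|` [fset diag_cell x i | i in iota 0 m]|.
  by rewrite card_imfset /= ?undup_id ?iota_uniq ?size_iota.
congr #|` _|; apply/fsetP => c; rewrite !inE; apply/imfsetP/andP => /=.
  move=> [j]; rewrite mem_iota /= => lti ->.
  by rewrite inP cont_diag_cell eqxx.
move=> [cL /eqP cx]; exists (minn c.1 c.2); last by rewrite -cx diag_cellK.
by rewrite mem_iota /= add0n -inP -cx diag_cellK.
Qed.

Lemma profP L : downset L ->
  forall c : nat * nat, (c \in L) = (c.1 + c.2 < prof L (cont c))%N.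
Proof.
move=> dL c; rewrite -{1}(diag_cellK c) diag_cardP // /prof.
have := sum_diag_cell (cont c) (minn c.1 c.2); rewrite diag_cellK; lia.
Qed.

(** Were the jump larger than one, the last cell of the longer diagonal would have its left or upper
    neighbour outside [L]. Equality is excluded by parity. *)
Lemma prof_step L : downset L ->
  forall x, prof L x = (prof L (x - 1)).+1 \/ prof L (x - 1) = (prof L x).+1.
Proof.
move=> dL x.
have up1 : (prof L x <= (prof L (x - 1)).+1)%N.
  rewrite leqNgt; apply/negP => lt_f.
  have cL : diag_cell x (diag_card L x).-1 \in L.
    by rewrite diag_cardP //; move: lt_f; rewrite /prof; lia.
  have := sum_diag_cell x (diag_card L x).-1.
  move: (cont_diag_cell x (diag_card L x).-1) cL.
  case: (diag_cell _ _) => i [|j]; rewrite /cont /= => cx cL.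
    by move: lt_f; rewrite /prof; lia.
  have : (i, j) \in L by apply: dL cL _ _ => /=.
  rewrite profP // /cont /= (_ : j%:Z - i%:Z = x - 1); last by lia.
  by move: lt_f; rewrite /prof; lia.
have up2 : (prof L (x - 1) <= (prof L x).+1)%N.
  rewrite leqNgt; apply/negP => lt_f.
  have cL : diag_cell (x - 1) (diag_card L (x - 1)).-1 \in L.
    by rewrite diag_cardP //; move: lt_f; rewrite /prof; lia.
  have := sum_diag_cell (x - 1) (diag_card L (x - 1)).-1.
  move: (cont_diag_cell (x - 1) (diag_card L (x - 1)).-1) cL.
  case: (diag_cell _ _) => [[|i] j]; rewrite /cont /= => cx cL.
    by move: lt_f; rewrite /prof; lia.
  have : (i, j) \in L by apply: dL cL _ _ => /=.
  rewrite profP // /cont /= (_ : j%:Z - i%:Z = x); last by lia.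
  by move: lt_f; rewrite /prof; lia.
move: up1 up2; rewrite /prof; lia.
Qed.

Lemma downset_closed (S : cells) :
    (forall i j : nat, (i, j.+1) \in S -> (i, j) \in S) ->
    (forall i j : nat, (i.+1, j) \in S -> (i, j) \in S) -> downset S.
Proof.
move=> left above [i j] [i' j'] /= ijS lei lej.
have : (i', j) \in S.
  move: ijS; rewrite -(subnK lei); elim: (i - i')%N => // k IHk.
  by rewrite addSn => /above.
rewrite -(subnK lej); elim: (j - j')%N => // k IHk.
by rewrite addSn => /left.
Qed.

(** Converse of [prof_step] and [profP]: it serves to recognise a set built from a modified profile
    as a diagram. *)
Lemma downset_steps (f : int -> nat) L :
    (forall x, f x = (f (x - 1)).+1 \/ f (x - 1) = (f x).+1) ->
    (forall c : nat * nat, (c \in L) = (c.1 + c.2 < f (cont c))%N) ->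
  downset L.
Proof.
move=> step LP.
apply: downset_closed => i j; rewrite !LP /cont /= => ltf.
  have := step (j.+1%:Z - i%:Z).
  by rewrite (_ : j.+1%:Z - i%:Z - 1 = j%:Z - i%:Z); lia.
have := step (j%:Z - i%:Z).
by rewrite (_ : j%:Z - i%:Z - 1 = j%:Z - i.+1%:Z); lia.
Qed.

Lemma downset_lt_card L (c : nat * nat) : downset L -> c \in L ->
  (c.1 < #|` L|)%N /\ (c.2 < #|` L|)%N.
Proof.
case: c => a b dL cL.
have bound (g : nat -> nat * nat) k : injective g ->
    (forall i, (i < k.+1)%N -> g i \in L) -> (k < #|` L|)%N.
  move=> g_inj gL; rewrite -(size_iota 0 k.+1) -(size_map g).
  apply: uniq_leq_size; first by rewrite map_inj_uniq ?iota_uniq.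
  by move=> x /mapP[i i_k ->]; apply: gL; rewrite mem_iota in i_k.
split.
  by apply: (bound (fun i => (i, b))) => [i j []//|i lei]; apply: dL cL _ _.
by apply: (bound (pair a)) => [i j []//|i lei]; apply: dL cL _ _.
Qed.

Lemma prof_far L x : downset L -> (#|` L| <= `|x|)%N -> prof L x = `|x|%N.
Proof.
move=> dL farx; rewrite /prof; have := diag_cardP dL x 0.
case: (boolP (_ \in _)) => [cL _|_ /esym]; last by lia.
have [] := downset_lt_card dL cL.
by move: farx; rewrite /diag_cell; case: ifP => /=; lia.
Qed.

Lemma bead_left L (x : int) : downset L -> x <= - #|` L|%:Z -> bead L x.
Proof. by move=> dL lex; rewrite /bead !prof_far //; lia. Qed.

Lemma bead_right L (x : int) : downset L -> #|` L|%:Z < x -> bead L x = false.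
Proof. by move=> dL lex; rewrite /bead !prof_far //; lia. Qed.

Lemma downset_bead_inj L M : downset L -> downset M -> bead L = bead M -> L = M.
Proof.
move=> dL dM eqb; apply/fsetP => c; rewrite !profP //; congr (_ < _)%N.
(* Up to [x0] both profiles equal the absolute value; from there on the beads dictate every unit
   step. *)
set x0 : int := - (#|` L| + #|` M|)%:Z.
have [lex|ltx] := leP (cont c) x0; first by rewrite !prof_far //; lia.
rewrite (_ : cont c = x0 + `|cont c - x0|%N%:Z); last by lia.
elim: `|_|%N => [|k IHk]; first by rewrite addr0 !prof_far //; lia.
have := congr1 (fun s : maya => s (x0 + k.+1%:Z)) eqb; rewrite /bead.
have := prof_step dL (x0 + k.+1%:Z); have := prof_step dM (x0 + k.+1%:Z).
by rewrite (_ : x0 + k.+1%:Z - 1 = x0 + k%:Z); lia.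
Qed.

(** * Ribbons *)

Lemma downset_intpart L : downset L -> exists la, diagram la = L.
Proof.
move=> dL; have /choice[row rowP] i : exists m, forall j, ((i,
  j) \in L) = (j < m)%N.
  apply: initial_segment => [u v [] //|t t' le_t inL].
  exact: (dL _ (i, t') inL).
have row_anti i i' : (i <= i')%N -> (row i' <= row i)%N.
  move=> lei; case: (posnP (row i')) => [-> //|gt0].
  have inL : (i', (row i').-1) \in L by rewrite rowP; lia.
  by have := dL _ (i, (row i').-1) inL lei (leqnn _); rewrite rowP; lia.
have exN : exists i, row i == 0%N.
  exists #|` L|; rewrite -leqn0 leqNgt; apply/negP; rewrite -rowP.
  by move=> /(downset_lt_card dL)[]; rewrite ltnn.
case: (ex_minnP exN) => m /eqP m0 minm.
have s_ok : sorted geq (mkseq row m) && (0%N \notin mkseq row m).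
  apply/andP; split.
    apply/(sortedP 0%N) => i; rewrite size_mkseq => lti.
    by rewrite !nth_mkseq ?(ltnW lti) //; apply: row_anti.
  apply/mapP => -[j]; rewrite mem_iota add0n => /= lti /esym/eqP/minm.
  by rewrite leqNgt lti.
exists (IntPart s_ok); apply/fsetP => -[i j]; rewrite mem_diagram rowP /=.
have [lti|lei] := ltnP i m; first by rewrite nth_mkseq.
by rewrite nth_default ?size_mkseq //; have := row_anti _ _ lei; lia.
Qed.

Definition convex (S : cells) : Prop :=
  forall c d e : nat * nat, c \in S -> e \in S ->
    (c.1 <= d.1 <= e.1)%N -> (c.2 <= d.2 <= e.2)%N -> d \in S.

Lemma convex_diff L M : downset L -> downset M -> convex (M `\` L).
Proof.
move=> dL dM c d e; rewrite !inE =>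
  /andP[cL _] /andP[_ eM] /andP[le1 le1'] /andP[le2 le2'].
rewrite (dM _ _ eM) // andbT; apply: contra cL => /dL; exact.
Qed.

(* [p] is the content of the bottom-left square of the ribbon. *)
Record rib (n : nat) (p : int) (S : cells) : Prop := Rib {
  rib_convex : convex S;
  rib_inj : {in S &, injective cont};
  rib_cont : forall x, (exists2 c, c \in S &
    cont c = x) <-> p <= x < p + n%:Z }.

Lemma rib_mem n p S c : rib n p S -> c \in S -> p <= cont c < p + n%:Z.
Proof. by case=> _ _ contS cS; apply/contS; exists c. Qed.

Lemma rib_mono n p S (c d : nat * nat) : rib n p S -> c \in S -> d \in S ->
  cont c <= cont d -> (d.1 <= c.1)%N && (c.2 <= d.2)%N.
Proof.
move=> ribS cS dS; case: ribS => cvx inj _.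
rewrite /cont => le_cd; apply/andP; split; rewrite leqNgt; apply/negP => lt.
  have eS : (c.1.+1, c.2.+1) \in S by apply: cvx cS dS _ _ => /=; lia.
  by have := inj _ _ cS eS; rewrite /cont /= => h; have := congr1 fst (h _);
    rewrite /=; lia.
have eS : (d.1.+1, d.2.+1) \in S by apply: cvx dS cS _ _ => /=; lia.
by have := inj _ _ dS eS; rewrite /cont /= => h; have := congr1 fst (h _);
  rewrite /=; lia.
Qed.

Lemma rib_next n p S (c d : nat * nat) : rib n p S -> c \in S -> d \in S ->
  cont d = cont c + 1 -> d = (c.1, c.2.+1) \/ c = (d.1.+1, d.2).
Proof.
move=> ribS cS dS eq_cd; have := rib_mono ribS cS dS;
  rewrite eq_cd lerDl => /(_ isT).
move: eq_cd; case: c cS => i j cS; case: d dS => i' j' dS;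
  rewrite /cont /= => eq_cd /andP[lei lej].
have [eqi|neqi] := eqVneq i i'; first by left; congr pair; lia.
by right; congr pair; lia.
Qed.

Lemma cards_shift (p : int) n : #|` [fset p + i%:Z | i in iota 0 n]| = n.
Proof.
rewrite card_imfset /= ?undup_id ?iota_uniq ?size_iota //.
by move=> i j; lia.
Qed.

Lemma mem_shift (p x : int) n :
  (x \in [fset p + i%:Z | i in iota 0 n]) = (p <= x < p + n%:Z).
Proof.
apply/imfsetP/idP => /= [[i + ->]|le_x]; first by rewrite mem_iota; lia.
by exists `|x - p|%N; rewrite ?mem_iota; lia.
Qed.

Lemma rib_contE n p S : rib n p S ->
  [fset cont c | c in S] = [fset p + i%:Z | i in iota 0 n].
Proof.
case=> _ _ contS; apply/fsetP => x; rewrite mem_shift; apply/imfsetP/idP => /=.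
  by move=> [c cS ->]; apply/contS; exists c.
by move=> /contS[c cS <-]; exists c.
Qed.

Lemma rib_card n p S : rib n p S -> #|` S| = n.
Proof.
move=> ribS; rewrite -[RHS](cards_shift p) -(rib_contE ribS).
by rewrite card_in_imfset //; case: ribS.
Qed.

Lemma seq_int_min (s : seq int) : s != [::] ->
  exists2 x, x \in s & forall y, y \in s -> x <= y.
Proof.
elim: s => // x s IHs _; have [->|/IHs[z zs zmin]] := eqVneq s [::].
  by exists x => [|y]; rewrite inE // => /eqP->.
have [lexz|ltzx] := leP x z.
  exists x => [|y]; rewrite inE ?eqxx // => /predU1P[->//|/zmin].
  exact: le_trans.
exists z => [|y]; rewrite inE ?zs ?orbT // => /predU1P[->|/zmin//].
exact: ltW.
Qed.

Lemma adjacent_cont c d : adjacent c d ->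
  cont d = cont c + 1 \/ cont c = cont d + 1.
Proof. by case: c d => [i j] [i' j']; rewrite /adjacent /cont /=; lia. Qed.

Lemma is_ribbon_rib n S : (0 < n)%N -> is_ribbon n S -> exists p, rib n p S.
Proof.
move=> n_gt0 [[al [be [le_ab SE]]] conS cardS no22].
have cvx : convex S by rewrite SE; apply: convex_diff; apply: downset_diagram.
(* Two cells on one diagonal span a rectangle, which convexity places in [S] and which contains a
   2x2 square. *)
have inj : {in S &, injective cont}.
  suff inj_lt c d : c \in S -> d \in S -> cont c = cont d -> (c.1 < d.1)%N ->
    False.
    move=> [i j] [i' j'] cS dS eq_cd; have [lt|lt|eq1] := ltngtP i i'.
    - by case: (inj_lt _ _ cS dS eq_cd).
    - by case: (inj_lt _ _ dS cS (esym eq_cd)).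
    by move: eq_cd; rewrite /cont eq1 /= => eq2; congr pair; lia.
  case: c d => [i j] [i' j'] cS dS; rewrite /cont /= => eq_cd lti; apply: no22.
  exists i, j; split=> //; apply: (cvx _ _ _ cS dS) => /=; lia.
(* Contents change by one along an edge path, so they take every intermediate value. *)
have ivt x y z : x \in S -> y \in S -> cont x <= z <= cont y ->
    exists2 c, c \in S & cont c = z.
  move=> xS yS; have /connectP[s] := conS [` xS] [` yS].
  have -> : cont x = cont (val [` xS]) by [].
  have -> : cont y = cont (val [` yS]) by [].
  move: [` xS] [` yS] => {}x {}y + -> {xS yS}.
  elim: s x => [|w s IHs] x /=; first by move=> _ lez; exists (val x);
    [exact: valP|exact/le_anti].
  move=> /andP[adj /IHs{}IHs] lez.
  have [->|neqz] := eqVneq z (cont (val x)); first by exists (val x) => //;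
    exact: valP.
  by apply: IHs; move: lez neqz (adjacent_cont adj) => /=; lia.
have [p /mapP[c0 c0S ->] minp] : exists2 x, x \in [seq cont c | c <- S] &
    forall y, y \in [seq cont c | c <- S] -> x <= y.
  by apply: seq_int_min; rewrite -size_eq0 size_map cardS -lt0n.
have minS c : c \in S -> cont c0 <= cont c by move=> cS; apply/minp/map_f.
exists (cont c0); split=> // x.
have cardK : #|` [fset cont c | c in S]| = n by rewrite card_in_imfset.
have sub : [fset cont c | c in S] `<=` [fset cont c0 + i%:Z | i in iota 0 n].
  apply/fsubsetP => _ /imfsetP[c cS ->]; rewrite mem_shift minS //= ltNge.
  (* A content at distance at least [n] from the least one would force [n + 1] distinct contents on
     [n] cells. *)
  apply/negP => gec; suff : (n < n)%N by rewrite ltnn.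
  rewrite -[X in (X <= _)%N](cards_shift (cont c0)) -[X in (_ <= X)%N]cardK.
  apply/fsubset_leq_card/fsubsetP => z; rewrite mem_shift => lez.
  have [|d dS <-] := ivt c0 c z c0S cS; first lia.
  by apply/imfsetP; exists d.
have /eqP eqK : [fset cont c | c in S] == [fset cont c0 + i%:Z | i in iota 0 n].
  by rewrite eqEfcard sub cards_shift cardK leqnn.
rewrite -mem_shift -eqK; split=> [[c cS <-]|/imfsetP[c cS ->]];
  last by exists c.
by apply/imfsetP; exists c.
Qed.

Definition box (a b : nat) : cells :=
  [fset d in [seq (i, j) | i <- iota 0 a, j <- iota 0 b]].

Lemma mem_box a b (d : nat * nat) : (d \in box a b) = (d.1 < a)%N &&
  (d.2 < b)%N.
Proof.
rewrite /box !inE; apply/allpairsPdep/idP => [[i [j [+ + ->]]]|led].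
  by rewrite !mem_iota /=; lia.
by exists d.1, d.2; rewrite !mem_iota; split; [lia|lia|case: (d)].
Qed.

Lemma rib_is_ribbon n p S : (0 < n)%N -> rib n p S -> is_ribbon n S.
Proof.
move=> n_gt0 ribS; split; last first.
- move=> [i [j [ijS _ _ dS]]]; have := rib_inj ribS ijS dS.
  by rewrite /cont /= => /(_ _)/(congr1 fst) /=; lia.
- exact: rib_card ribS.
- have sym (u v : S) : adjacent (val u) (val v) = adjacent (val v) (val u).
    by rewrite /adjacent; lia.
  suff con k (x y : S) : cont (val y) = cont (val x) + k%:Z ->
      connect (fun u v : S => adjacent (val u) (val v)) x y.
    move=> x y; have [lexy|ltyx] := leP (cont (val x)) (cont (val y)).
      by apply: (con `|cont (val y) - cont (val x)|%N); lia.
    rewrite sym_connect_sym //.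
    by apply: (con `|cont (val y) - cont (val x)|%N); lia.
  elim: k y => [|k IHk] y eqk.
    rewrite (_ : x = y) ?connect0 //; apply/val_inj.
    by apply: (rib_inj ribS (valP x) (valP y)); move: eqk => /= ->;
      rewrite addr0.
  have [z zS zE] : exists2 z, z \in S & cont z = cont (val x) + k%:Z.
    apply/(rib_cont ribS); move: (rib_mem ribS (valP x)) (rib_mem ribS (valP
      y)).
    by move: eqk => /=; lia.
  apply: connect_trans (IHk [` zS] zE) (connect1 _) => /=.
  have := rib_next ribS zS (valP y); rewrite zE eqk /adjacent => h.
  have [|->|->] /= := h; lia.
(* The outer diagram is the order ideal generated by [S]; convexity makes what remains after
   deleting [S] an order ideal as well. *)
pose be := \bigcup_(c <- S) box c.1.+1 c.2.+1.
have mem_be (d : nat * nat) : reflect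
    (exists2 c : nat * nat, c \in S & (d.1 <= c.1)%N &&
      (d.2 <= c.2)%N) (d \in be).
  apply: (iffP (bigfcupP _ _ _ _)) => [[c]|[c cS]].
    by rewrite andbT => cS; rewrite mem_box !ltnS; exists c.
  by exists c; rewrite ?andbT // mem_box !ltnS.
have sub : S `<=` be by apply/fsubsetP => c cS; apply/mem_be; exists c;
  rewrite ?leqnn.
have dbe : downset be.
  move=> c d /mem_be[e eS lee] led1 led2; apply/mem_be; exists e => //; lia.
have dal : downset (be `\` S).
  move=> c d; rewrite !inE => /andP[cS cbe] led1 led2.
  rewrite (dbe c d) // andbT; apply: contra cS => dS.
  have [e eS lee] := mem_be _ cbe.
  by apply: (rib_convex ribS dS eS); lia.
have [la laE] := downset_intpart dal; have [mu muE] := downset_intpart dbe.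
exists la, mu; rewrite /Defs.skew laE muE fsubsetDl; split=> //.
apply/fsetP => c; have := fsubsetP sub c; rewrite !in_fsetD.
by case: (c \in S); case: (c \in be) => //= /(_ isT).
Qed.

Lemma rib_diag_card n p B x : rib n p B ->
  diag_card B x = (p <= x < p + n%:Z)%R.
Proof.
move=> ribB; rewrite /diag_card; have [in_x|nin_x] := boolP (p <= x < p + n%:Z).
  have /(rib_cont ribB)[c cB cx] := in_x.
  rewrite (_ : [fset _ | _ in _ & _] = [fset c]) ?cardfs1 //.
  apply/fsetP => d; rewrite !inE; apply/andP/eqP => [[dB /eqP dx]|->].
    by apply: (rib_inj ribB) => //; rewrite dx.
  by rewrite cB cx.
rewrite (_ : [fset _ | _ in _ & _] = fset0) ?cardfs0 //.
apply/fsetP => d; rewrite !inE; apply/negP => /andP[dB /eqP dx].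
by have := rib_mem ribB dB; rewrite dx (negbTE nin_x).
Qed.

Lemma prof_add n p L B x : [disjoint L & B] -> rib n p B ->
  prof (L `|` B) x = (prof L x + 2 * (p <= x < p + n%:Z)%R)%N.
Proof.
move=> LB ribB; rewrite /prof -addnA -mulnDr -(rib_diag_card _ ribB);
  congr (_ + 2 * _)%N.
rewrite /diag_card (_ : [fset _ | _ in _ `|` _ & _] =
  [fset c in L | cont c == x] `|` [fset c in B | cont c == x]); last first.
  by apply/fsetP => c; rewrite !inE andb_orl.
rewrite cardfsU (_ : _ `&` _ = fset0) ?cardfs0 ?subn0 //.
apply/fsetP => c; rewrite !inE; apply/negP => /andP[/andP[cL _] /andP[cB _]].
by have := fdisjointP LB c cL; rewrite cB.
Qed.

(** Being outside [L] gives height at least the profile, being inside the union gives height below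
    the profile plus two, and the parity of heights on a diagonal leaves one value. *)
Lemma rib_height n p L B (c : nat * nat) : downset L -> downset (L `|` B) ->
  [disjoint L & B] ->
  rib n p B -> c \in B -> (c.1 + c.2 = prof L (cont c))%N.
Proof.
move=> dL dLB LB ribB cB.
have : c \in L `|` B by rewrite !inE cB orbT.
have : c \notin L by rewrite fdisjoint_sym in LB; exact: fdisjointP LB c cB.
rewrite !profP // (prof_add _ LB ribB) (rib_mem ribB cB) muln1 /prof.
have := sum_diag_cell (cont c) (minn c.1 c.2); rewrite diag_cellK /=; lia.
Qed.

(** * Adding and removing one ribbon as a bead move *)

Section Moves.
Variable n : nat.
Hypothesis n_gt0 : (0 < n)%N.

(** The profile rises by two exactly on the contents of [B], which reverses its step at [p] and its
    step at [p + n] and no others. *)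
Lemma bead_add p L B : downset L -> downset (L `|` B) -> [disjoint L & B] ->
  rib n p B -> can_up n p (bead L) /\ bead (L `|` B) = up n p (bead L).
Proof.
move=> dL dLB LB ribB; have profE x := prof_add x LB ribB.
have stepL := prof_step dL; have stepM := prof_step dLB.
split.
  rewrite /can_up /bead; have := stepL p; have := stepM p; rewrite !profE.
  have := stepL (p + n%:Z); have := stepM (p + n%:Z); rewrite !profE; lia.
apply/funext => x; rewrite /up /bead !profE.
have := stepL x; have := stepM x; rewrite !profE.
have [->|neq] := eqVneq x p; first by lia.
by have [->|neq'] := eqVneq x (p + n%:Z); lia.
Qed.

Lemma image_iotaP (T : choiceType) (r : nat -> T) k x :
  reflect (exists2 j, (j < k)%N & x = r j) (x \in [fset r j | j in iota 0 k]).
Proof.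
by apply: (iffP (imfsetP _ _ _ _)) => -[j ltj ->]; exists j => //;
  move: ltj; rewrite [in_mem _ _]mem_iota.
Qed.

(** Used with [r] the row of the successive squares of a ribbon from its tail and [b] the beads, at
    which the ribbon climbs one row. *)
Lemma card_stairs (r : nat -> nat) (b : nat -> bool) m :
    (forall j, (0 < j <= m)%N -> r j.-1 = r j + b j)%N ->
  #|` [fset r j | j in iota 0 m.+1]| = (\sum_(1 <= j < m.+1) b j).+1.
Proof.
elim: m => [|m IHm] step.
  rewrite big_geq // (_ : [fset _ | _ in _] = [fset r 0%N]) ?cardfs1 //.
  apply/fsetP => i; rewrite inE; apply/image_iotaP/eqP => [[[|//] _ ->]|->] //.
  by exists 0%N.
rewrite big_nat_recr // -addSn -IHm => [|j lej]; last by apply: step; lia.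
have -> : [fset r j | j in iota 0 m.+2] =
    r m.+1 |` [fset r j | j in iota 0 m.+1].
  apply/fsetP => i; rewrite in_fset1U; apply/image_iotaP/orP => [[j ltj ->]|].
    have [->|neq] := eqVneq j m.+1; first by left.
    by right; apply/image_iotaP; exists j => //; lia.
  case=> [/eqP->|/image_iotaP[j ltj ->]]; first by exists m.+1.
  by exists j => //; lia.
rewrite cardfsU1 addnC; congr (_ + _)%N.
have stepm : (r m = r m.+1 + b m.+1)%N by apply: (step m.+1); lia.
have anti j : (j <= m)%N -> (r m <= r j)%N.
  elim: m {IHm stepm} step => [|m IHm] step; first by rewrite leqn0 => /eqP->.
  rewrite leq_eqVlt => /predU1P[->//|ltj].
  have : r m = (r m.+1 + b m.+1)%N by apply: (step m.+1); lia.
  have : (r m <= r j)%N by apply: IHm => // i lei; apply: step; lia.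
  by lia.
case: (b m.+1) stepm => stepm.
  by apply/eqP; rewrite eqb1; apply/negP => /image_iotaP[j ltj];
    have := anti j; lia.
apply/eqP; rewrite eqb0 negbK; apply/image_iotaP; exists m => //; lia.
Qed.

Lemma ribbon_spin_between p L B : downset L -> downset (L `|` B) ->
  [disjoint L & B] ->
  rib n p B -> ribbon_spin B = between n p (bead L).
Proof.
move=> dL dLB LB ribB; have heightE := rib_height dL dLB LB ribB.
(* The row of the square of content [p + j]: row plus column is the profile, column minus row is the
   content. *)
pose r (j : nat) := (absz ((prof L (p + j%:Z)%R)%:Z - (p + j%:Z))%R %/ 2)%N.
have rE (c : nat * nat) : c \in B -> c.1 = r `|cont c - p|%N.
  move=> cB; have := heightE c cB; have := rib_mem ribB cB; rewrite /r.
  move=> lec; rewrite (_ : p + `|cont c - p|%N%:Z = cont c); last by lia.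
  by move=> <-; rewrite /cont; lia.
rewrite /ribbon_spin.
rewrite (_ : [fset c.1 | c in B] = [fset r j | j in iota 0 n.-1.+1]).
  rewrite (card_stairs (b := fun j => bead L (p + j%:Z))) /between ?prednK //.
  move=> j ltj; have := prof_step dL (p + j%:Z).
  rewrite /r /bead (_ : p + j%:Z - 1 = p + j.-1%:Z); last by lia.
  by rewrite /prof; lia.
rewrite prednK //; apply/fsetP => i;
  apply/imfsetP/image_iotaP => [[c cB ->]|[j ltj ->]].
  exists `|cont c - p|%N; last exact: rE.
  by have := rib_mem ribB cB; lia.
have [c cB cE] : exists2 c, c \in B &
  cont c = p + j%:Z by apply/(rib_cont ribB); lia.
by exists c => //; rewrite rE // cE; congr r; lia.
Qed.

Lemma rib_of_height p L B : downset L -> downset (L `|` B) ->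
  [disjoint L & B] ->
    (forall x : int, p <= x < p + n%:Z -> exists2 c, c \in B & cont c = x) ->
    (forall c : nat * nat, c \in B ->
      p <= cont c < p + n%:Z /\ (c.1 + c.2 = prof L (cont c))%N) ->
  rib n p B.
Proof.
move=> dL dLB LB exB BP; split.
- have -> : B = (L `|` B) `\` L; last exact: convex_diff.
  apply/fsetP => c; rewrite !inE; case cB: (c \in B);
    rewrite ?orbF ?orbT ?andNb //.
  by rewrite andbT; apply/esym; rewrite fdisjoint_sym in LB;
    exact: fdisjointP LB c cB.
- move=> c d cB dB eq_cd; have [_ hc] := BP c cB; have [_ hd] := BP d dB.
  by apply: cell_eq => //; rewrite hc hd eq_cd.
- by move=> x; split=> [[c /BP[+ _] <-] //|/exB].
Qed.

Lemma bead_ex p L : downset L -> can_up n p (bead L) ->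
  exists B, [/\ rib n p B, [disjoint L & B] & downset (L `|` B)].
Proof.
move=> dL canL.
(* The first cell outside [L] on each diagonal from [p] to [p + n - 1]. *)
pose B :=
  [fset diag_cell (p + j%:Z) (diag_card L (p + j%:Z)) | j in iota 0 n].
have BP (c : nat * nat) : (c \in B) =
    (p <= cont c < p + n%:Z) && ((c.1 + c.2)%N == prof L (cont c)).
  apply/image_iotaP/andP => [[j ltj ->]|[lec /eqP hc]].
    by rewrite cont_diag_cell sum_diag_cell; split; [lia|exact/eqP].
  exists `|cont c - p|%N; first by lia.
  rewrite (_ : p + `|cont c - p|%N%:Z = cont c); last by lia.
  by apply: cell_eq; rewrite ?cont_diag_cell // sum_diag_cell.
have LB : [disjoint L & B].
  apply/fdisjointP => c; rewrite profP // BP => ltc;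
    apply/negP => /andP[_ /eqP eqc].
  by rewrite eqc ltnn in ltc.
have dLB : downset (L `|` B).
  pose f x := (prof L x + 2 * (p <= x < p + n%:Z)%R)%N.
  apply: (@downset_steps f) => [x|c].
    move: canL; rewrite /can_up /bead /f.
    have := prof_step dL x; have := prof_step dL p;
      have := prof_step dL (p + n%:Z).
    have [->|neq] := eqVneq x p; first by lia.
    by have [->|neq'] := eqVneq x (p + n%:Z); lia.
  rewrite in_fsetU BP profP // /f /prof.
  have := sum_diag_cell (cont c) (minn c.1 c.2); rewrite diag_cellK /=; lia.
exists B; split=> //; apply: (rib_of_height dL dLB LB) => [x lex|c].
  exists (diag_cell x (diag_card L x)); last exact: cont_diag_cell.
  by rewrite BP cont_diag_cell lex sum_diag_cell eqxx.
by rewrite BP => /andP[lec /eqP].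
Qed.

Lemma prof_lipschitz L x y : downset L -> (prof L x <= prof L y + `|x - y|)%N.
Proof.
move=> dL; suff dist u k : (prof L (u + k%:Z) <= prof L u + k)%N /\
    (prof L u <= prof L (u + k%:Z) + k)%N.
  have [lexy|ltyx] := leP x y.
    have := dist x `|y - x|%N; rewrite (_ : x + _ = y); lia.
  have := dist y `|x - y|%N; rewrite (_ : y + _ = x); lia.
elim: k => [|k IHk]; first by rewrite addr0; lia.
have := prof_step dL (u + k.+1%:Z).
by rewrite (_ : u + k.+1%:Z - 1 = u + k%:Z); lia.
Qed.

Lemma bead_rm p M : downset M -> can_down n p (bead M) ->
  exists B, [/\ rib n p B, B `<=` M & downset (M `\` B)].
Proof.
move=> dM canM.
(* Each of these diagonals has a cell to lose. For [x <= 0] this follows from the rise of the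
   profile at [p], for [x > 0] from its fall at [p + n], since slopes are at most one. It also keeps
   the subtraction in [f] below from being truncated. *)
have big x : p <= x < p + n%:Z -> (`|x| + 2 <= prof M x)%N.
  move=> lex; move: canM; rewrite /can_down /bead.
  have := prof_lipschitz p x dM; have := prof_lipschitz (p + n%:Z - 1) x dM.
  have := prof_step dM p; have := prof_step dM (p + n%:Z).
  by rewrite /prof; lia.
pose f x := (prof M x - 2 * (p <= x < p + n%:Z)%R)%N.
pose L := [fset c in M | (c.1 + c.2 < f (cont c))%N].
have LP (c : nat * nat) : (c \in L) = (c.1 + c.2 < f (cont c))%N.
  rewrite !inE profP //; apply: andb_idl => lt_c.
  exact: leq_trans lt_c (leq_subr _ _).
have dL : downset L.
  apply: (@downset_steps f) => [x|//].
  move: canM; rewrite /can_down /bead /f.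
  have := prof_step dM x; have := prof_step dM p;
    have := prof_step dM (p + n%:Z).
  have := big x; have := big (x - 1).
  have [->|neq] := eqVneq x p; first by lia.
  by have [->|neq'] := eqVneq x (p + n%:Z); lia.
have LM : L `<=` M by apply/fsubsetP => c; rewrite !inE => /andP[].
have LE : M `\` (M `\` L) = L.
  apply/fsetP => c; have := fsubsetP LM c; rewrite !in_fsetD.
  by case: (c \in M); case: (c \in L) => //= /(_ isT).
exists (M `\` L); split; rewrite ?fsubsetDl ?LE //.
have BP (c : nat * nat) : (c \in M `\` L) =
    (p <= cont c < p + n%:Z) && ((c.1 + c.2).+2 == prof M (cont c)).
  rewrite in_fsetD LP profP // /f; have := big (cont c).
  have := sum_diag_cell (cont c) (minn c.1 c.2); rewrite diag_cellK /=.
  by rewrite /prof; lia.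
split; first exact: convex_diff.
- move=> c d; rewrite !BP => /andP[_ /eqP hc] /andP[_ /eqP hd] eq_cd.
  by apply: cell_eq => //; move: hc hd; rewrite eq_cd; lia.
move=> x; split=> [[c + <-]|lex]; first by rewrite BP => /andP[].
exists (diag_cell x (diag_card M x).-1); last exact: cont_diag_cell.
rewrite BP cont_diag_cell lex sum_diag_cell /=.
by have := big x lex; rewrite /prof; lia.
Qed.
End Moves.

Lemma downset_left S (i j : nat) : downset S -> (i, j.+1) \in S -> (i, j) \in S.
Proof. by move=> dS /dS; apply => //=; apply: leqnSn. Qed.

Lemma downset_above S (i j : nat) : downset S -> (i.+1, j) \in S ->
  (i, j) \in S.
Proof. by move=> dS /dS; apply => //=; apply: leqnSn. Qed.

Lemma rib_head n p B (c : nat * nat) : (0 < n)%N -> rib n p B ->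
  is_topright B c <-> c \in B /\ cont c = p + n%:Z - 1.
Proof.
move=> n_gt0 ribB.
have [h hB hE] : exists2 h, h \in B & cont h = p + n%:Z - 1.
  by apply/(rib_cont ribB); lia.
split=> [[cB top]|[cB cE]]; split=> //.
  have := top h hB; have := rib_mem ribB cB; have := rib_mem ribB hB.
  by move: hE; case: (h) (c) => [i j] [i' j']; rewrite /cont /=; lia.
move=> d dB; apply/andP; apply: (rib_mono ribB dB cB).
by have := rib_mem ribB dB; lia.
Qed.

Section Tilings.
Variable n : nat.
Hypothesis n_gt0 : (0 < n)%N.

(* The ribbon of a horizontal strip whose tail is leftmost runs along the
   boundary of L: this propagates from its head, which touches the north,
     down to
   its tail, since a ribbon squeezed in between would start further left. *)
Section FirstRibbon.
Variables (L M : cells) (P : {fset cells}) (B : cells) (p : int).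
Hypotheses (dL : downset L) (dM : downset M) (tilP : is_htiling n (M `\` L) P).
Hypotheses (BP : B \in P) (ribB : rib n p B).
Hypothesis minB : forall (B' : cells) p', B' \in P -> rib n p' B' -> p <= p'.

Let tiling_ex (c : nat * nat) : c \in M `\` L ->
  exists2 B', B' \in P & c \in B'.
Proof.
case: tilP => -[_ _ <-] _ /bigfcupP[B']; rewrite andbT; by exists B'.
Qed.

Let tiling_sub (B' : cells) (c : nat * nat) : B' \in P -> c \in B' ->
  c \in M `\` L.
Proof.
by case: tilP => -[_ _ <-] _ B'P cB'; apply/bigfcupP; exists B'; rewrite ?andbT.
Qed.

Let tiling_disj (B' : cells) (c : nat * nat) : B' \in P -> c \in B ->
  c \in B' -> B' = B.
Proof.
case: tilP => -[_ /trivIfsetP triv _] _ B'P cB cB'.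
have [//|neq] := eqVneq B' B.
by have := fdisjointP (triv _ _ B'P BP neq) c cB'; rewrite cB.
Qed.

Let tiling_tail (B' : cells) : B' \in P -> exists p', rib n p' B'.
Proof. by case: tilP => -[rb _ _] _ /rb /(is_ribbon_rib n_gt0). Qed.

Let north (c : nat * nat) : c \in B -> cont c = p + n%:Z - 1 ->
  c.1 = 0%N \/ (c.1.-1, c.2) \in L.
Proof.
move=> cB cE; have [_ /(_ _ BP)[h hB hN]] := tilP.
have [hinB hE] := (rib_head h n_gt0 ribB).1 hB.
have hc : h = c by apply: (rib_inj ribB) => //; rewrite hE.
case: hN; rewrite hc; first by left.
move=> nS; right; apply: contraNT nS => nL; rewrite in_fsetD nL /=.
have := tiling_sub BP cB; rewrite in_fsetD => /andP[_ /dM]; apply => //=.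
exact: leq_pred.
Qed.

Let corner (c : nat * nat) : c \in B ->
  [\/ c.1 = 0%N, c.2 = 0%N | (c.1.-1, c.2.-1) \in L].
Proof.
move=> cB; have := rib_mem ribB cB.
have [k] : exists k : nat, cont c = p + n%:Z - 1 - k%:Z.
  by exists (absz (p + n%:Z - 1 - cont c)%R); have := rib_mem ribB cB; lia.
elim: k c cB => [|k IHk] c cB kE lec.
  have [c0|cL] := north cB (etrans kE (subr0 _)); first by constructor 1.
  by constructor 3; apply: (dL cL) => //=; exact: leq_pred.
have [d dB dE] : exists2 d, d \in B & cont d = cont c + 1.
  by apply/(rib_cont ribB); lia.
have cornd : [\/ d.1 = 0%N, d.2 = 0%N | (d.1.-1, d.2.-1) \in L].
  by apply: IHk => //; rewrite dE; lia.
have [eqd|eqc] := rib_next ribB cB dB dE.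
  move: cornd; rewrite eqd /= => -[->|//|inL]; first by constructor 1.
  by constructor 3; apply: (dL inL) => //=; exact: leq_pred.
have [j0|j_gt0] := posnP c.2; first by constructor 2.
constructor 3; apply: contraT => nL.
case: d dB dE cornd eqc => [i j] /= dB dE cornd eqc;
  rewrite eqc /= in nL j_gt0 *.
have cS : (i, j.-1) \in M `\` L.
  rewrite in_fsetD nL /=; have := tiling_sub BP dB;
    rewrite in_fsetD => /andP[_ /dM].
  by apply => //=; exact: leq_pred.
have [B' B'P cB'] := tiling_ex cS; have [p' ribB'] := tiling_tail B'P.
have lep := minB B'P ribB'; have := rib_mem ribB' cB'.
have xE : cont (i, j.-1) = cont c by rewrite eqc /cont /=; lia.
rewrite xE => lex.
(* As [p <= p'], the ribbon [B'] also reaches the diagonal of [d]: either at [d], which belongs to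
   [B], or at the north-west neighbour of [d], which by induction lies in [L] if it exists. *)
have [e eB' eE] : exists2 e, e \in B' & cont e = cont (i, j.-1) + 1.
  by apply/(rib_cont ribB'); rewrite xE; have := rib_mem ribB dB; lia.
have [ee|ee] := rib_next ribB' cB' eB' eE.
  rewrite ee /= prednK // in eB'.
  have eqB := tiling_disj B'P dB eB'; rewrite eqB in cB'.
  have := rib_inj ribB cB' cB xE; rewrite eqc => -[]; lia.
have := tiling_sub B'P eB'; rewrite in_fsetD => /andP[neL _].
case: e ee neL {eE eB'} => i' j' [ii jj] /=; rewrite -jj => neL.
move: cornd; rewrite /= ii => -[//||]; first by lia.
by rewrite (negbTE neL).
Qed.

Lemma first_ribbon_height (c : nat * nat) :
  c \in B -> (c.1 + c.2 = prof L (cont c))%N.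
Proof.
move=> cB; have := tiling_sub BP cB; rewrite in_fsetD => /andP[+ _].
have := corner cB; rewrite (profP dL c) -leqNgt.
have := sum_diag_cell (cont c) (minn c.1 c.2); rewrite diag_cellK /prof.
case: (c) => i j /= sumE [-> | -> | ]; try by rewrite /cont /=; lia.
case: i sumE => [|i] sumE; first by rewrite /cont /=; lia.
case: j sumE => [|j] sumE; first by rewrite /cont /=; lia.
by rewrite profP // /cont /= (_ : j%:Z - i%:Z = j.+1%:Z - i.+1%:Z) /prof; lia.
Qed.

(** A left neighbour whose content is below [p] would lie in a ribbon starting further left, and an
    upper neighbour beyond the head is in [L] because the head touches the north. Any other
    neighbour outside [L] has to be the square of [B] on its diagonal. *)
Lemma first_ribbon_downset : downset (L `|` B).
Proof.
have BM c : c \in B -> c \in M.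
  by move=> /(tiling_sub BP); rewrite in_fsetD => /andP[].
have same (c d : nat * nat) : c \in B -> d \notin L -> cont c = cont d ->
    (d.1 + d.2 <= prof L (cont d))%N -> d \in B.
  move=> cB nL eqx led; suff <- : c = d by [].
  apply: cell_eq => //; move: nL; rewrite profP // -leqNgt.
  by have := first_ribbon_height cB; rewrite eqx; lia.
apply: downset_closed => i j; rewrite !in_fsetU.
  case/orP => [/(downset_left dL)->//|cB].
  have [//|nL /=] := boolP ((i, j) \in L).
  have cE : cont (i, j) = cont (i, j.+1) - 1 by rewrite /cont /=; lia.
  have [lep|ltp] := leP p (cont (i, j)).
    have [d dB dE] : exists2 d, d \in B & cont d = cont (i, j).
      by apply/(rib_cont ribB); have := rib_mem ribB cB; lia.
    apply: (same d) => //; have := first_ribbon_height cB; rewrite cE /=.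
    by have := prof_step dL (cont (i, j.+1)); lia.
  have cS : (i, j) \in M `\` L.
    by rewrite in_fsetD nL (downset_left dM (BM _ cB)).
  have [B' B'P cB'] := tiling_ex cS; have [p' ribB'] := tiling_tail B'P.
  have lep := minB B'P ribB'; have := rib_mem ribB' cB'; lia.
case/orP => [/(downset_above dL)->//|cB].
have [//|nL /=] := boolP ((i, j) \in L).
have cE : cont (i.+1, j) = cont (i, j) - 1 by rewrite /cont /=; lia.
have [ltp|lep] := ltP (cont (i, j)) (p + n%:Z).
  have [d dB dE] : exists2 d, d \in B & cont d = cont (i, j).
    by apply/(rib_cont ribB); have := rib_mem ribB cB; lia.
  apply: (same d) => //; have := first_ribbon_height cB; rewrite cE /=.
  by have := prof_step dL (cont (i, j)); lia.
have cN : cont (i.+1, j) = p + n%:Z - 1 by have := rib_mem ribB cB; lia.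
by have [//|/= iL] := north cB cN; rewrite iL in nL.
Qed.

End FirstRibbon.

End Tilings.

(** * Ribbon strips as sequences of bead moves *)

Lemma rib_first n p B : (0 < n)%N -> rib n p B ->
  exists2 c, c \in B & cont c = p.
Proof.
by move=> n_gt0 ribB; apply/(rib_cont ribB); rewrite lexx ltrDl ltz_nat.
Qed.

Lemma rib_tail_uniq n p p' B : (0 < n)%N -> rib n p B -> rib n p' B -> p = p'.
Proof.
move=> n_gt0 ribB ribB'.
have [c cB cE] := rib_first n_gt0 ribB.
have [c' cB' cE'] := rib_first n_gt0 ribB'.
have := rib_mem ribB cB'; have := rib_mem ribB' cB; lia.
Qed.

Section Tilings.
Variable n : nat.
Hypothesis n_gt0 : (0 < n)%N.

(** Ribbons are peeled off by increasing tail, each becoming part of the lower shape. The last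
    clause carries the tails through the induction, where they give the sortedness of the moves. *)
Lemma htiling_moves (L M : cells) (P : {fset cells}) :
    downset L -> downset M -> L `<=` M -> is_htiling n (M `\` L) P ->
  exists t, [/\ [/\ sorted <%R t, can_moves (can_up n) (up n) t (bead L)
                  & moves (up n) t (bead L) = bead M],
      size t = #|` P|, spin P = moves_spin n (up n) t (bead L)
    & forall p, p \in t -> exists2 B, B \in P & rib n p B].
Proof.
have [k] := ubnP #|` P|; elim: k L P => // k IHk L P;
  rewrite ltnS => leP dL dM LM tilP.
have [P0|[B0 B0P]] := fset_0Vmem P.
  have ML : M = L.
    case: tilP => -[_ _]; rewrite P0 /fcover big_seq_fset0 => LM0 _.
    by apply/eqP; rewrite eqEfsubset LM andbT -fsetD_eq0 -LM0.
  by exists [::]; rewrite P0 ML /spin big_seq_fset0.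
have /choice[tl tlP] : forall B : cells, exists p, B \in P -> rib n p B.
  move=> B; have [BP|nBP] := boolP (B \in P); last by exists 0.
  by case: tilP => -[/(_ _ BP)/(is_ribbon_rib n_gt0)[p ribB] _ _] _; exists p.
have [p /mapP[B BP pE] minp] : exists2 x, x \in map tl P &
  forall y, y \in map tl P -> x <= y.
  apply: seq_int_min; apply/eqP => P0; have := map_f tl B0P.
  by rewrite P0.
have ribB : rib n p B by rewrite pE; apply: tlP.
have minB (B' : cells) p' : B' \in P -> rib n p' B' -> p <= p'.
  move=> B'P ribB'; rewrite -(rib_tail_uniq n_gt0 (tlP _ B'P) ribB').
  exact/minp/map_f.
have dLB := first_ribbon_downset n_gt0 dL dM tilP BP ribB minB.
have [[rbP /trivIfsetP triv cov] topP] := tilP.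
have subS (B' : cells) c : B' \in P -> c \in B' -> c \in M `\` L.
  by move=> B'P cB'; rewrite -cov; apply/bigfcupP; exists B'; rewrite ?andbT.
have LB : [disjoint L & B].
  rewrite fdisjoint_sym; apply/fdisjointP => c /(subS _ _ BP).
  by rewrite in_fsetD => /andP[].
have LBM : L `|` B `<=` M.
  rewrite fsubUset LM; apply/fsubsetP => c /(subS _ _ BP).
  by rewrite in_fsetD => /andP[].
pose P' := P `\ B.
have P'P (B' : cells) : B' \in P' -> B' \in P by rewrite in_fsetD1 => /andP[].
have tilP' : is_htiling n (M `\` (L `|` B)) P'.
  split; last first.
    move=> B' /P'P/topP[c top [c0|nc]]; exists c => //; first by left.
    by right; apply: contra nc;
      rewrite !in_fsetD in_fsetU negb_or => /andP[/andP[-> _] ->].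
  split; first by move=> B' /P'P/rbP.
    by apply/trivIfsetP => B1 B2 /P'P B1P /P'P B2P; exact: triv.
  apply/fsetP => c; apply/bigfcupP/idP => [[B' + cB']|].
    rewrite andbT in_fsetD1 => /andP[neq B'P]; have := subS _ _ B'P cB'.
    rewrite !in_fsetD in_fsetU negb_or => /andP[-> ->]; rewrite andbT /=.
    exact: fdisjointP (triv _ _ B'P BP neq) _ cB'.
  rewrite in_fsetD in_fsetU negb_or => /andP[/andP[cL cB] cM].
  have : c \in fcover P by rewrite cov in_fsetD cL.
  case/bigfcupP => B'; rewrite andbT => B'P cB'; exists B' => //.
  by rewrite andbT in_fsetD1 B'P andbT; apply: contraNneq cB => <-.
have cardP : #|` P| = #|` P'|.+1 by rewrite (cardfsD1 B) BP.
have [|t [[srt cant mvt] szt spt tailt]] := IHk (L `|` B) P' _ dLB dM LBM tilP'.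
  by rewrite -ltnS -cardP.
have [canp beadE] := bead_add n_gt0 dL dLB LB ribB.
exists (p :: t); rewrite /= -beadE canp mvt cant szt cardP; split=> //.
- split=> //; rewrite path_sortedE; last exact: lt_trans.
  rewrite srt andbT; apply/allP => p' /tailt[B' B'P' ribB'].
  have B'P := P'P _ B'P'; rewrite lt_neqAle (minB _ _ B'P ribB') andbT.
  (* Two ribbons with the same least tail would both have their tail square at the height of the
     profile of [L], hence share it. *)
  apply/eqP => eqp; rewrite -eqp in ribB'.
  have [c cB cE] := rib_first n_gt0 ribB.
  have [c' cB' cE'] := rib_first n_gt0 ribB'.
  have minB' (B1 : cells) p1 : B1 \in P -> rib n p1 B1 ->
    p <= p1 by exact: minB.
  have cc' : c = c'.
    apply: cell_eq; first by rewrite cE cE'.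
    rewrite (first_ribbon_height n_gt0 dL dM tilP BP ribB minB cB).
    by rewrite (first_ribbon_height n_gt0 dL dM tilP B'P ribB' minB' cB') cE
      cE'.
  move: B'P'; rewrite in_fsetD1 => /andP[neq _].
  by have := fdisjointP (triv _ _ B'P BP neq) _ cB'; rewrite -cc' cB.
- rewrite -spt /spin (big_fsetD1 B BP) /=; congr (_ + _)%N.
  exact: ribbon_spin_between dL dLB LB ribB.
- move=> p'; rewrite inE => /predU1P[->|/tailt[B' /P'P B'P ribB']];
  first by exists B.
  by exists B'.
Qed.

Lemma moves_htiling (L : cells) t : downset L -> sorted <%R t ->
    can_moves (can_up n) (up n) t (bead L) ->
  exists M P, [/\ downset M, L `<=` M, bead M = moves (up n) t (bead L),
     is_htiling n (M `\` L) P
   & forall B, B \in P -> exists2 p, p \in t & rib n p B].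
Proof.
elim: t L => [|p t IHt] L dL /=.
  move=> _ _; exists L, fset0; split=> //; rewrite fsetDv.
  split; last by move=> B; rewrite in_fset0.
  split; first by move=> B; rewrite in_fset0.
    by apply/trivIfsetP => B; rewrite in_fset0.
  by rewrite /fcover big_seq_fset0.
rewrite path_sortedE; last exact: lt_trans.
move=> /andP[/allP ltt srt] /andP[canp].
have [B [ribB LB dLB]] := bead_ex n_gt0 dL canp.
have [_ <-] := bead_add n_gt0 dL dLB LB ribB.
move=> /(IHt _ dLB srt)[M [P [dM LBM beadM [[rbP trivP cov] topP] tailP]]].
have [LM BM] : L `<=` M /\ B `<=` M by move: LBM; rewrite fsubUset => /andP[].
have BL c : c \in B -> c \notin L.
  by move=> cB; rewrite fdisjoint_sym in LB; exact: fdisjointP LB c cB.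
have subS (B' : cells) c : B' \in P -> c \in B' -> c \in M `\` (L `|` B).
  by move=> B'P cB'; rewrite -cov; apply/bigfcupP; exists B'; rewrite ?andbT.
exists M, (B |` P); split=> //; last first.
  move=> B'; rewrite in_fset1U => /predU1P[->|/tailP[p' p't ribB']].
    by exists p; rewrite ?inE ?eqxx.
  by exists p'; rewrite ?inE ?p't ?orbT.
split; last first.
  move=> B'; rewrite in_fset1U => /predU1P[->|B'P].
    have [c cB cE] : exists2 c, c \in B & cont c = p + n%:Z - 1.
      by apply/(rib_cont ribB); lia.
    exists c; first by apply/(rib_head c n_gt0 ribB).
    case: c cB cE => [[|i] j] cB cE; first by left.
    (* The square above the head has content [p + n], too large for [B], so it must come from
       [L]. *)
    right; rewrite in_fsetD negb_and negbK /=; apply/orP; left.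
    have : (i, j) \in L `|` B by apply: (downset_above dLB);
      rewrite in_fsetU cB orbT.
    rewrite in_fsetU => /orP[//|/(rib_mem ribB)].
    by move: cE; rewrite /cont /=; lia.
  have [c top nc] := topP _ B'P; exists c => //.
  have [p' /ltt ltp ribB'] := tailP _ B'P.
  have [cB' cE] := (rib_head c n_gt0 ribB').1 top.
  case: nc; first by left.
  case: c top cB' cE => [[|i] j] /= top cB' cE nc; first by left.
  (* Restoring [B] to the shape does not block this head: the square above it has content [p' + n],
     larger than all contents of [B]. *)
  right; apply: contra nc; rewrite !in_fsetD in_fsetU negb_or => /andP[-> ->].
  rewrite andbT /=; apply/negP => /(rib_mem ribB).
  by move: cE; rewrite /cont /=; lia.
split.
- move=> B'; rewrite in_fset1U => /predU1P[->|/rbP//].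
  exact: rib_is_ribbon ribB.
- have BP (B' : cells) : B' \in P -> [disjoint B & B'].
    move=> B'P; rewrite fdisjoint_sym; apply/fdisjointP => c /(subS _ _ B'P).
    by rewrite in_fsetD in_fsetU !negb_or => /andP[/andP[]].
  apply/trivIfsetP => B1 B2; rewrite !in_fset1U.
  move=> /predU1P[->|B1P] /predU1P[->|B2P]; rewrite ?eqxx // => neq.
  - exact: BP.
  - by rewrite fdisjoint_sym; exact: BP.
  - by have /trivIfsetP := trivP; apply.
apply/fsetP => c; apply/bigfcupP/idP => [[B' + cB']|].
  rewrite andbT in_fset1U => /predU1P[eqB|/subS/(_ cB')].
    by rewrite eqB in cB'; rewrite in_fsetD BL //= (fsubsetP BM).
  by rewrite !in_fsetD in_fsetU negb_or => /andP[/andP[-> _] ->].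
rewrite in_fsetD => /andP[cL cM].
have [cB|ncB] := boolP (c \in B).
  by exists B => //; rewrite andbT fset1U1.
have : c \in fcover P by rewrite cov in_fsetD in_fsetU negb_or cL ncB.
by case/bigfcupP => B'; rewrite andbT => B'P cB'; exists B' => //;
  rewrite andbT in_fset1U B'P orbT.
Qed.

End Tilings.

(** * Transposition and reflected bead configurations *)

Lemma mem_transpose S (c : nat * nat) : (c \in transpose S) = ((c.2,
  c.1) \in S).
Proof.
apply/imfsetP/idP => /= [[[i j] ijS ->] //|cS]; exists (c.2, c.1) => //.
by case: (c).
Qed.

Lemma transposeD S S' : transpose (S `\` S') = transpose S `\` transpose S'.
Proof. by apply/fsetP => c; rewrite in_fsetD !mem_transpose in_fsetD. Qed.

Lemma transpose_fsubset S S' : S `<=` S' -> transpose S `<=` transpose S'.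
Proof.
by move=> /fsubsetP sub; apply/fsubsetP => c; rewrite !mem_transpose;
  apply: sub.
Qed.

Lemma transposeU S S' : transpose (S `|` S') = transpose S `|` transpose S'.
Proof. by apply/fsetP => c; rewrite in_fsetU !mem_transpose in_fsetU. Qed.

Lemma transpose_inj : injective transpose.
Proof. exact: can_inj transposeK. Qed.

Lemma downset_transpose L : downset L -> downset (transpose L).
Proof. by move=> dL c d; rewrite !mem_transpose => /dL + le1 le2; apply. Qed.

Lemma rib_transpose n p S : rib n p S -> rib n (1 - p - n%:Z) (transpose S).
Proof.
have contT (c : nat * nat) : cont (c.2, c.1) = - cont c by rewrite /cont /=;
  lia.
move=> ribS; have lec (c : nat * nat) : c \in S -> p <= cont c < p + n%:Z.
  exact: rib_mem.
case: ribS => cvx inj contS; split.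
- move=> c d e; rewrite !mem_transpose => cS eS led1 led2.
  by apply: cvx cS eS _ _.
- move=> [i j] [i' j']; rewrite !mem_transpose => cS dS eq_cd.
  have := inj _ _ cS dS; rewrite !contT eq_cd => /(_ erefl) [-> ->].
  by [].
move=> x; split=> [[c + <-]|lex].
  by rewrite mem_transpose => /lec; rewrite contT; lia.
have [|c cS cE] := (contS (- x)).2; first by lia.
exists (c.2, c.1); first by rewrite mem_transpose; case: (c) cS.
by rewrite contT cE opprK.
Qed.

Lemma prof_transpose L x : prof (transpose L) x = prof L (- x).
Proof.
rewrite /prof abszN; congr (_ + 2 * _)%N; rewrite /diag_card.
rewrite -[LHS](_ : #|` transpose [fset c in L | cont c == - x]| = _);
  last first.
  congr #|` _|; apply/fsetP => c; rewrite mem_transpose !inE /= mem_transpose.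
  by congr (_ && _); rewrite /cont /=; lia.
by rewrite card_imfset //= => -[i j] [i' j'] /= [-> ->].
Qed.

(** Transposing reflects the boundary path and exchanges its vertical and horizontal steps, so beads
    become holes. *)
Definition flip (s : maya) : maya := fun x => ~~ s (1 - x).

Lemma flipK : involutive flip.
Proof. by move=> s; apply/funext => x; rewrite /flip negbK; congr s; lia. Qed.

Lemma bead_transpose L : downset L -> bead (transpose L) = flip (bead L).
Proof.
move=> dL; apply/funext => x; rewrite /bead /flip !prof_transpose.
have e1 : 1 - x - 1 = - x by lia.
have e2 : - (x - 1) = 1 - x by lia.
by have := prof_step dL (1 - x); rewrite e1 e2; lia.
Qed.

Section Flip.
Variable n : nat.
Hypothesis n_gt0 : (0 < n)%N.

Definition flip_pos (p : int) : int := 1 - p - n%:Z.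

Lemma flip_posK : involutive flip_pos.
Proof. by move=> p; rewrite /flip_pos; lia. Qed.

Lemma up_flip p s : up n p (flip s) = flip (up n (flip_pos p) s).
Proof.
apply/funext => x; rewrite /up /flip /flip_pos.
have [->|neq] := eqVneq x p; first by rewrite ifF ?ifT //; lia.
have [->|neq'] := eqVneq x (p + n%:Z); first by rewrite ifT //; lia.
by rewrite !ifF //; lia.
Qed.

Lemma can_up_flip p s : can_up n p (flip s) = can_up n (flip_pos p) s.
Proof.
rewrite /can_up /flip /flip_pos negbK andbC.
by congr (s _ && ~~ s _); lia.
Qed.

(** Each of the [n - 1] intermediate sites is filled in exactly one of the two configurations. *)
Lemma between_flip p s :
  (between n p (flip s) + between n (flip_pos p) s = n.-1)%N.
Proof.
rewrite /between [X in (_ + X)%N]big_nat_rev -big_split /=.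
rewrite (eq_big_nat _ _ (F2 := fun=> 1%N)) => [|j ltj].
  by rewrite sum_nat_const_nat muln1 subn1.
rewrite /flip /flip_pos.
by rewrite (_ : 1 - (p + j%:Z) = 1 - p - n%:Z + (1 + n - j.+1)%N%:Z);
  [case: (s _)|lia].
Qed.

Lemma can_moves_flip t s : can_moves (can_up n) (up n) t (flip s) =
  can_moves (can_up n) (up n) (map flip_pos t) s.
Proof.
by elim: t s => //= p t IHt s; rewrite up_flip can_up_flip IHt.
Qed.

Lemma moves_flip t s :
  moves (up n) t (flip s) = flip (moves (up n) (map flip_pos t) s).
Proof. by elim: t s => //= p t IHt s; rewrite up_flip IHt. Qed.

Lemma moves_spin_flip t s :
  (moves_spin n (up n) t (flip s) + moves_spin n (up n) (map flip_pos t) s =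
   size t * n.-1)%N.
Proof.
elim: t s => //= p t IHt s; rewrite up_flip mulSn.
rewrite -(IHt (up n (flip_pos p) s)) -(between_flip p s).
by rewrite addnACA.
Qed.

Lemma sorted_flip t : sorted >%R (map flip_pos t) = sorted <%R t.
Proof.
rewrite sorted_map; apply: eq_sorted => x y /=; rewrite /flip_pos /=; lia.
Qed.

(** The classical fact that an n-ribbon has [n + 1] rows and columns in total, read off from
    [between_flip]. *)
Lemma ribbon_spin_transpose B : is_ribbon n B ->
  (ribbon_spin (transpose B) + ribbon_spin B = n.-1)%N.
Proof.
move=> rbB; have [p ribB] := is_ribbon_rib n_gt0 rbB.
case: rbB => -[al [be [le_ab BE]]] _ _ _.
have dal := @downset_diagram al; have dbe := @downset_diagram be.
have LB : [disjoint diagram al & B].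
  rewrite fdisjoint_sym; apply/fdisjointP => c.
  by rewrite BE in_fsetD => /andP[].
have dLB : downset (diagram al `|` B) by rewrite BE /Defs.skew fsetUDl fsetDv
  fsetD0 (fsetUidPr _ _ le_ab).
rewrite (ribbon_spin_between n_gt0 dal dLB LB ribB).
have LB' : [disjoint transpose (diagram al) & transpose B].
  apply/fdisjointP => c; rewrite !mem_transpose; exact: (fdisjointP LB).
rewrite (ribbon_spin_between n_gt0 _ _ LB' (rib_transpose ribB)) -?transposeU;
  try exact: downset_transpose.
rewrite bead_transpose // -/(flip_pos p).
by rewrite -{2}(flip_posK p) between_flip.
Qed.

End Flip.

(** * Strips and their statistics in terms of moves *)

Section Strips.
Variable n : nat.
Hypothesis n_gt0 : (0 < n)%N.

Definition maya_of (la : intpart) : maya := bead (diagram la).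

Lemma maya_of_inj : injective maya_of.
Proof.
move=> la mu /downset_bead_inj eq_d.
by apply/diagram_inj/eq_d; apply: downset_diagram.
Qed.

Lemma hstripP mu la : is_hstrip n mu la <->
  exists t, [/\ sorted <%R t, can_moves (can_up n) (up n) t (maya_of la)
              & moves (up n) t (maya_of la) = maya_of mu].
Proof.
split=> [[le_lm [P tilP]]|[t [srt cant mvt]]].
  have [t [ht _ _ _]] := htiling_moves n_gt0 (@downset_diagram la)
    (@downset_diagram mu) le_lm tilP.
  by exists t.
have [M [P [dM LM beadM tilP _]]] :=
  moves_htiling n_gt0 (@downset_diagram la) srt cant.
have ME : M = diagram mu.
  by apply: downset_bead_inj => //; [exact: downset_diagram|rewrite beadM].
by rewrite ME in LM tilP; split=> //; exists P.
Qed.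

Lemma hstrip_stats mu la t : is_hstrip n mu la -> sorted <%R t ->
    can_moves (can_up n) (up n) t (maya_of la) ->
    moves (up n) t (maya_of la) = maya_of mu ->
  size t = hcount n mu la /\ moves_spin n (up n) t (maya_of la) = hspin n mu la.
Proof.
move=> strip srt cant mvt; have tilP := htilingP strip; have [le_lm _] := strip.
have [t' [[srt' cant' mvt'] szt' spt' _]] := htiling_moves n_gt0
  (@downset_diagram la) (@downset_diagram mu) le_lm tilP.
rewrite (moves_up_increasing_inj n_gt0 srt srt' cant cant');
  first by rewrite szt' -spt'.
by rewrite mvt mvt'.
Qed.

Lemma vstripP mu la : is_vstrip n mu la <->
  exists t, [/\ sorted >%R t, can_moves (can_up n) (up n) t (maya_of la)
              & moves (up n) t (maya_of la) = maya_of mu].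
Proof.
have dla := @downset_diagram la; have dmu := @downset_diagram mu.
have flipE nu : bead (transpose (diagram nu)) = flip (maya_of nu).
  exact: bead_transpose (@downset_diagram nu).
split=> [[le_lm [P]]|[t [srt cant mvt]]].
  rewrite /is_vtiling /Defs.skew transposeD => tilP.
  have [t [[srt + +] _ _ _]] := htiling_moves n_gt0 (downset_transpose dla)
    (downset_transpose dmu) (transpose_fsubset le_lm) tilP.
  rewrite !flipE can_moves_flip // moves_flip // => cant /(can_inj flipK) mvt.
  by exists (map (flip_pos n) t); rewrite sorted_flip.
have tE : t = map (flip_pos n) (map (flip_pos n) t).
  by rewrite mapK //; exact: flip_posK.
rewrite tE sorted_flip // in srt; rewrite tE -can_moves_flip // -flipE in cant.
have [M [P [dM LM beadM tilP rbP]]] :=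
  moves_htiling n_gt0 (downset_transpose dla) srt cant.
have ME : M = transpose (diagram mu).
  apply: downset_bead_inj => //; first exact: downset_transpose.
  by rewrite beadM !flipE moves_flip // -tE mvt.
rewrite ME in LM tilP; split.
  by rewrite -(transposeK (diagram la)) -(transposeK (diagram mu))
    transpose_fsubset.
exists [fset transpose B | B in P]; rewrite /is_vtiling /Defs.skew transposeD.
rewrite (_ : [fset transpose B | B in _] = P) //.
apply/fsetP => B; apply/imfsetP/idP => [[_ /imfsetP[B' B'P ->] ->]|BP].
  by rewrite transposeK.
by exists (transpose B); rewrite ?transposeK //; apply/imfsetP; exists B.
Qed.

Lemma vstrip_stats mu la t : is_vstrip n mu la -> sorted >%R t ->
    can_moves (can_up n) (up n) t (maya_of la) ->
    moves (up n) t (maya_of la) = maya_of mu ->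
  size t = vcount n mu la /\ moves_spin n (up n) t (maya_of la) = vspin n mu la.
Proof.
move=> strip srt cant mvt; have := vtilingP strip; have [le_lm _] := strip.
have dla := @downset_diagram la; have dmu := @downset_diagram mu.
rewrite /vspin /vcount; set P := vtiling _ _.
rewrite /is_vtiling /Defs.skew transposeD => tilP.
have [t' [[srt' cant' mvt'] szt' spt' _]] :=
  htiling_moves n_gt0 (downset_transpose dla)
    (downset_transpose dmu) (transpose_fsubset le_lm) tilP.
have flipE nu : bead (transpose (diagram nu)) = flip (maya_of nu).
  exact: bead_transpose (@downset_diagram nu).
rewrite !flipE can_moves_flip // moves_flip // in cant' mvt' spt'.
have tE : t = map (flip_pos n) t'.
  apply: (moves_up_decreasing_inj n_gt0 srt _ cant) => //;
    first by rewrite sorted_flip.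
  by rewrite mvt; apply/esym/(can_inj flipK).
have rbP (B : cells) : B \in P -> is_ribbon n B.
  move=> BP; rewrite -(transposeK B).
  case: tilP => -[/(_ (transpose B)) rb _ _] _.
  have [|p ribB] := is_ribbon_rib n_gt0 (rb _); first by apply/imfsetP;
    exists B.
  exact: rib_is_ribbon n_gt0 (rib_transpose ribB).
have cardP : #|` [fset transpose B | B in P]| = #|` P|.
  by rewrite card_imfset //; exact: transpose_inj.
rewrite tE size_map szt' cardP; split=> //.
(* The tiling of the transposed shape yields the spins of transposed ribbons. Ribbon spins and move
   spins both complement to [n - 1] per ribbon under transposition, so the transposed parts
   cancel. *)
have := moves_spin_flip n_gt0 t' (maya_of la).
rewrite -spt' szt' cardP /spin.
rewrite big_imfset /=; last by move=> B B' _ _; exact: transpose_inj.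
have : (\sum_(B <- P) (ribbon_spin (transpose B) + ribbon_spin B) =
  #|` P| * n.-1)%N.
  rewrite big_seq (eq_bigr (fun=> n.-1)) => [|B BP]; last first.
    exact: ribbon_spin_transpose (rbP B BP).
  by rewrite -big_seq big_const_seq iter_addn_0 count_predT mulnC.
rewrite big_split /= => <- /addnI; exact.
Qed.

End Strips.

Section StripSums.
Variable n : nat.
Hypothesis n_gt0 : (0 < n)%N.

Definition weight_of (la : intpart) : nat := #|` diagram la|.

Lemma removes_ribbonP la nu : removes_ribbon n la nu <->
  exists2 p, can_up n p (maya_of nu) & maya_of la = up n p (maya_of nu).
Proof.
have dla := @downset_diagram la; have dnu := @downset_diagram nu.
split=> [[sub rb]|[p canp eqla]].
  have [p ribB] := is_ribbon_rib n_gt0 rb; set B := Defs.skew _ _ in rb ribB.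
  have LB : [disjoint diagram nu & B].
    rewrite fdisjoint_sym; apply/fdisjointP => c.
    by rewrite in_fsetD => /andP[].
  have UE : diagram nu `|` B = diagram la.
    by rewrite /B /Defs.skew fsetUDl fsetDv fsetD0 (fsetUidPr _ _ sub).
  have [] := bead_add n_gt0 dnu _ LB ribB; rewrite UE // => canp eqla.
  by exists p.
have [B [ribB LB dLB]] := bead_ex n_gt0 dnu canp.
have [_ eqB] := bead_add n_gt0 dnu dLB LB ribB.
have UE : diagram nu `|` B = diagram la.
  by apply: downset_bead_inj => //; rewrite eqB -eqla.
split; first by rewrite -UE fsubsetUl.
rewrite /Defs.skew -UE fsetDUl fsetDv fset0U (fsetDidPl _ _ _).
  exact: rib_is_ribbon ribB.
by rewrite fdisjoint_sym.
Qed.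

Lemma weight_removes la nu : removes_ribbon n la nu ->
  weight_of la = (weight_of nu + n)%N.
Proof.
move=> [sub [_ _ <- _]]; rewrite /weight_of -(cardfsID (diagram nu) (diagram
  la)).
by rewrite (fsetIidPr sub).
Qed.

Lemma up_intpart p la : can_up n p (maya_of la) ->
  exists2 mu, maya_of mu = up n p (maya_of la) & removes_ribbon n mu la.
Proof.
move=> canp; have dla := @downset_diagram la.
have [B [ribB LB dLB]] := bead_ex n_gt0 dla canp.
have [_ eqB] := bead_add n_gt0 dla dLB LB ribB.
have [mu muE] := downset_intpart dLB.
have maya_mu : maya_of mu = up n p (maya_of la) by rewrite /maya_of muE eqB.
by exists mu => //; apply/removes_ribbonP; exists p.
Qed.

Lemma down_intpart p la : can_down n p (maya_of la) ->
  exists2 nu, maya_of nu = down n p (maya_of la) & removes_ribbon n la nu.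
Proof.
move=> canp; have dla := @downset_diagram la.
have [B [ribB BM dMB]] := bead_rm n_gt0 dla canp.
have [nu nuE] := downset_intpart dMB.
have dnu := @downset_diagram nu.
have LB : [disjoint diagram nu & B].
  by rewrite nuE; apply/fdisjointP => c; rewrite in_fsetD => /andP[].
have UE : diagram nu `|` B = diagram la.
  rewrite nuE; apply/fsetP => c; have := fsubsetP BM c;
    rewrite in_fsetU in_fsetD.
  by case: (c \in B) => [/(_ isT)->//|_]; rewrite orbF.
have [canp' eqla] : can_up n p (maya_of nu) /\ maya_of la = up n p (maya_of nu).
  by have [] := bead_add n_gt0 dnu _ LB ribB; rewrite UE.
exists nu; first by rewrite eqla upK.
by apply/removes_ribbonP; exists p.
Qed.

(** With at most [N] cells, a bead can move up only from a site in the range from [-N - n + 1] to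
    [N]. Starting at [-(N + n)] makes the first window entirely filled, and the window after [N] is
    empty. *)
Definition bottom_pos (N : nat) : int := - (N + n)%N%:Z.
Definition positions (N : nat) : seq int :=
  descend (bottom_pos N) (N + N + n).+1.

Lemma positions_can_up p la N : can_up n p (maya_of la) ->
  (weight_of la <= N)%N ->
  p \in positions N.
Proof.
have dla := @downset_diagram la.
rewrite /weight_of => /andP[bp nbp] leN; rewrite mem_descend /bottom_pos.
have : p <= #|` diagram la|%:Z.
  by rewrite leNgt; apply/negP => lt; move: bp; rewrite /maya_of bead_right.
have : - #|` diagram la|%:Z < p + n%:Z.
  by rewrite ltNge; apply: contra nbp => le; exact: bead_left.
by move: leN => /=; lia.
Qed.

Lemma moves_intpart t la N : can_moves (can_up n) (up n) t (maya_of la) ->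
    (weight_of la + size t * n <= N)%N ->
  exists mu, [/\ maya_of mu = moves (up n) t (maya_of la),
    weight_of mu = (weight_of la + size t * n)%N & {subset t <= positions N}].
Proof.
elim: t la => [|p t IHt] la /=; first by rewrite addn0; exists la.
move=> /andP[canp cant] leN;
  have [mu muE /weight_removes szmu] := up_intpart canp.
rewrite -muE in cant *.
have [|nu [nuE szE sub]] := IHt mu cant; first by rewrite szmu; lia.
exists nu; split=> //; first by rewrite szE szmu; lia.
move=> x; rewrite inE => /predU1P[->|/sub//].
by apply: positions_can_up canp _; lia.
Qed.

Lemma moves_down_intpart t la :
  can_moves (can_down n) (down n) t (maya_of la) ->
  exists2 mu, maya_of mu = moves (down n) t (maya_of la) &
    weight_of la = (weight_of mu + size t * n)%N.
Proof.
elim: t la => [|p t IHt] la /=; first by exists la; rewrite ?addn0.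
move=> /andP[canp cant]; have [mu muE /weight_removes szmu] :=
  down_intpart canp.
rewrite -muE in cant *; have [nu nuE szE] := IHt mu cant.
by exists nu => //; lia.
Qed.

Lemma window_top la N : (weight_of la <= N)%N ->
  window n (bottom_pos N + (N + N + n).+1%:Z) (maya_of la) = 0%N.
Proof.
move=> leN; rewrite /window big1_seq // => j; rewrite mem_index_iota => ltj.
rewrite /maya_of bead_right //; first exact: downset_diagram.
by move: leN; rewrite /weight_of /bottom_pos; lia.
Qed.

Lemma window_bottom la N : (weight_of la <= N)%N ->
  window n (bottom_pos N) (maya_of la) = n.
Proof.
move=> leN; rewrite /window (eq_big_nat _ _ (F2 := fun=> 1%N)) => [|j ltj].
  by rewrite sum_nat_const_nat muln1 subn0.
rewrite /maya_of bead_left //; first exact: downset_diagram.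
by move: leN; rewrite /weight_of /bottom_pos; lia.
Qed.

Lemma sorted_subset_subseq (T : eqType) (r : rel T) (s1 s2 : seq T) :
    transitive r -> irreflexive r -> sorted r s1 -> sorted r s2 ->
  {subset s1 <= s2} -> subseq s1 s2.
Proof.
move=> tr irr srt1 srt2 sub.
rewrite (irr_sorted_eq tr irr srt1 (sorted_filter tr (mem s1) srt2)).
  exact: filter_subseq.
by move=> x; rewrite mem_filter /=; case: (boolP (x \in s1)) => // /sub ->.
Qed.

(* Meaningful only when s is the bead configuration of a partition. *)
Definition shape_of (s : maya) : intpart :=
  xget (@IntPart [::] isT)
    [set la | maya_of la = s]%classic.

Lemma shape_ofK la : shape_of (maya_of la) = la.
Proof.
by rewrite /shape_of; case: xgetP => [mu _ /maya_of_inj //|/(_ la) /(_ erefl)].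
Qed.

End StripSums.

(** * Sums over strips as operator values *)

Section StripOps.
Variables (n : nat) (A : comNzRingType) (q : A).
Hypothesis n_gt0 : (0 < n)%N.

Local Notation can_ups := (can_moves (can_up n) (up n)).
Local Notation ups := (moves (up n)).

Section Generic.
Variables (r : rel int) (strip : intpart -> intpart -> Prop).
Variables (count sp : intpart -> intpart -> nat).
Hypotheses (r_tr : transitive r) (r_irr : irreflexive r).
Hypothesis stripP : forall mu la, strip mu la <->
  exists t, [/\ sorted r t, can_ups t (maya_of la) &
    ups t (maya_of la) = maya_of mu].
Hypothesis strip_stats : forall mu la t, strip mu la -> sorted r t ->
  can_ups t (maya_of la) -> ups t (maya_of la) = maya_of mu ->
  size t = count mu la /\ moves_spin n (up n) t (maya_of la) = sp mu la.
Hypothesis ups_inj : forall t t' s, sorted r t -> sorted r t' ->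
  can_ups t s -> can_ups t' s -> ups t s = ups t' s -> t = t'.

(** One statement for both orders [r]. The bijection sends a move sequence to the shape it reaches;
    the bound on [N] ensures that the moves of every relevant strip lie within [ps]. *)
Lemma ops_coef_strips ps N k la (psi : maya -> A) :
    sorted r ps -> ps =i positions n N -> (weight_of la + k * n <= N)%N ->
  ops_coef n q (can_up n) (up n) ps k psi (maya_of la) =
  \sum_(mu \in [set mu | strip mu la /\ count mu la = k]%classic)
    q ^+ sp mu la * psi (maya_of mu).
Proof.
move=> srt_ps psE leN; set s := maya_of la.
pose T := [seq t <- subs ps | can_ups t s && (size t == k)].
have uT : uniq T by rewrite filter_uniq // uniq_subs // (sorted_uniq r_tr
  r_irr).
have TP t : (t \in T) = [&& sorted r t, can_ups t s, size t == k &
  all (mem ps) t].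
  rewrite mem_filter mem_subs andbC;
    apply/andP/and4P => [[sub /andP[cant szt]]|].
    split=> //; first exact: subseq_sorted sub srt_ps.
    by apply/allP => x /(mem_subseq sub).
  move=> [srt cant szt /allP sub]; split; last exact/andP.
  exact: sorted_subset_subseq srt srt_ps sub.
pose h t := shape_of (ups t s).
have hK t : t \in T -> maya_of (h t) = ups t s.
  rewrite TP => /and4P[_ cant /eqP szt _].
  have [|mu [muE _ _]] := moves_intpart n_gt0 cant (N := N);
    first by rewrite szt.
  by rewrite /h -muE shape_ofK.
have hstrip t : t \in T -> strip (h t) la.
  by move=> tT; apply/stripP; exists t; rewrite hK //; move: tT;
    rewrite TP => /and4P[].
have hstats t : t \in T -> k = count (h t) la /\ moves_spin n (up n) t s =
  sp (h t) la.
  move=> tT; move: (tT); rewrite TP => /and4P[srt cant /eqP <- _].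
  by apply: strip_stats => //; rewrite ?hK //; apply: hstrip.
rewrite /ops_coef -big_filter -/T fsbig_seq //.
rewrite [RHS](reindex_fsbig h [set` T]%classic).
  apply: eq_fsbigr => t; rewrite inE /= => tT.
  by rewrite hK //; have [_ <-] := hstats t tT.
split.
- by move=> t /= tT; split; [exact: hstrip|have [<-] := hstats t tT].
- move=> t t'; rewrite !inE /= => tT t'T eqh.
  have := congr1 maya_of eqh; rewrite !hK //.
  by apply: ups_inj; [move: tT|move: t'T|move: tT|move: t'T];
    rewrite TP => /and4P[].
move=> mu /= [strip_mu cnt];
  have [t [srt cant mvt]] := (stripP mu la).1 strip_mu.
have [szt _] := strip_stats strip_mu srt cant mvt.
exists t; last by rewrite /h mvt shape_ofK.
rewrite /= TP srt cant szt cnt eqxx /=; apply/allP => x xt /=; rewrite psE.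
have [|_ [_ _ sub]] := moves_intpart n_gt0 cant (N := N);
  first by rewrite szt cnt.
exact: sub.
Qed.
End Generic.

Lemma vstrip_ops k la N (psi : maya -> A) : (weight_of la + k * n <= N)%N ->
  ops_coef n q (can_up n) (up n) (positions n N) k psi (maya_of la) =
  \sum_(mu \in [set mu | is_vstrip n mu la /\ vcount n mu la = k]%classic)
    q ^+ vspin n mu la * psi (maya_of mu).
Proof.
apply: (ops_coef_strips (r := >%R)) => //.
- by move=> x y z; lia.
- by move=> x; rewrite /= ltxx.
- exact: vstripP.
- by move=> mu l t; apply: vstrip_stats.
- exact: moves_up_decreasing_inj.
- exact: sorted_descend.
Qed.

Lemma hstrip_ops k la N (psi : maya -> A) : (weight_of la + k * n <= N)%N ->
  ops_coef n q (can_up n) (up n) (rev (positions n N)) k psi (maya_of la) =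
  \sum_(mu \in [set mu | is_hstrip n mu la /\ hcount n mu la = k]%classic)
    q ^+ hspin n mu la * psi (maya_of mu).
Proof.
apply: (ops_coef_strips (r := <%R)) => //.
- exact: lt_trans.
- exact: hstripP.
- by move=> mu l t; apply: hstrip_stats.
- exact: moves_up_increasing_inj.
- by rewrite rev_sorted; exact: sorted_descend.
- exact: mem_rev.
Qed.

Lemma hstrip_weight mu la : is_hstrip n mu la ->
  weight_of mu = (weight_of la + hcount n mu la * n)%N.
Proof.
move=> strip; have [t [srt cant mvt]] := (hstripP n_gt0 mu la).1 strip.
have [szt _] := hstrip_stats n_gt0 strip srt cant mvt.
have [nu [nuE + _]] := moves_intpart n_gt0 cant (leqnn _).
by rewrite szt; move: nuE; rewrite mvt => /maya_of_inj->.
Qed.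

Lemma vstrip_weight mu la : is_vstrip n mu la ->
  weight_of mu = (weight_of la + vcount n mu la * n)%N.
Proof.
move=> strip; have [t [srt cant mvt]] := (vstripP n_gt0 mu la).1 strip.
have [szt _] := vstrip_stats n_gt0 strip srt cant mvt.
have [nu [nuE + _]] := moves_intpart n_gt0 cant (leqnn _).
by rewrite szt; move: nuE; rewrite mvt => /maya_of_inj->.
Qed.

(** Decreasing removals read backwards are increasing additions, that is, a horizontal strip ending
    at [la]. *)
Lemma hstrip_remops (x : A) la N (psi : maya -> A) : (weight_of la <= N)%N ->
  remops n q x (positions n N) psi (maya_of la) =
  \sum_(nu \in [set nu | is_hstrip n la nu]%classic)
    q ^+ hspin n la nu * x ^+ hcount n la nu * psi (maya_of nu).
Proof.
move=> leN; set s := maya_of la; set ps := positions n N.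
have srt_ps : sorted >%R ps by exact: sorted_descend.
have gt_tr : transitive (>%R : rel int) by move=> u v w; lia.
have gt_irr : irreflexive (>%R : rel int) by move=> u; rewrite /= ltxx.
pose T := [seq t <- subs ps | can_moves (can_down n) (down n) t s].
have uT : uniq T by rewrite filter_uniq // uniq_subs // (sorted_uniq gt_tr
  gt_irr).
have TP t : t \in T -> sorted >%R t /\ can_moves (can_down n) (down n) t s.
  by rewrite mem_filter mem_subs => /andP[-> /(subseq_sorted gt_tr)/(_ srt_ps)].
pose h t := shape_of (moves (down n) t s).
have hK t : t \in T -> maya_of (h t) = moves (down n) t s.
  move=> /TP[_ cant]; have [nu nuE _] := moves_down_intpart n_gt0 cant.
  by rewrite /h -nuE shape_ofK.
have hstats t : t \in T -> [/\ is_hstrip n la (h t), size t = hcount n la (h t)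
    & moves_spin n (down n) t s = hspin n la (h t)].
  move=> tT; have [srt cant] := TP t tT.
  have [] := moves_down_rev n_gt0 cant; rewrite -hK // => cant' mvt' <-.
  have strip : is_hstrip n la (h t).
    by apply/(hstripP n_gt0); exists (rev t); rewrite rev_sorted.
  rewrite -size_rev; have [] := hstrip_stats n_gt0 strip _ cant' mvt' => //.
  by rewrite rev_sorted.
rewrite /remops ops_sum -big_filter -/T fsbig_seq //.
rewrite [RHS](reindex_fsbig h [set` T]%classic).
  apply: eq_fsbigr => t; rewrite inE /= => tT.
  by rewrite hK //; have [_ <- <-] := hstats t tT; rewrite [q ^+ _ * _]mulrC.
split.
- by move=> t /= tT; have [] := hstats t tT.
- move=> t t'; rewrite !inE /= => tT t'T eqh; apply: (can_inj revK).
  have [srt cant] := TP t tT; have [srt' cant'] := TP t' t'T.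
  have [ct mt _] := moves_down_rev n_gt0 cant.
  have [ct' mt' _] := moves_down_rev n_gt0 cant'.
  rewrite -hK // in ct mt; rewrite -hK // -eqh in ct' mt'.
  by apply: (moves_up_increasing_inj n_gt0) ct ct' _;
    rewrite ?rev_sorted // mt mt'.
move=> nu /= strip; have [t [srt cant mvt]] := (hstripP n_gt0 la nu).1 strip.
have [ct mt _] := moves_up_rev n_gt0 cant; rewrite mvt in ct mt.
exists (rev t); last by rewrite /h mt shape_ofK.
rewrite /= mem_filter ct mem_subs /=.
apply: (sorted_subset_subseq gt_tr gt_irr _ srt_ps);
  first by rewrite rev_sorted.
move=> u; rewrite mem_rev => ut;
  have [szt _] := hstrip_stats n_gt0 strip srt cant mvt.
have [|_ [_ _ sub]] := moves_intpart n_gt0 cant (N := N); last exact: sub.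
by rewrite szt -(hstrip_weight strip).
Qed.

End StripOps.

(** * Cores *)

Section Cores.
Variable n : nat.
Hypothesis n_gt0 : (0 < n)%N.

Local Notation reduces := (clos_refl_trans_1n intpart (removes_ribbon n)).
Local Notation is_core ka := (~ exists nu, removes_ribbon n ka nu).

Lemma is_core_ofE la ka : is_core_of n la ka <-> reduces la ka /\ is_core ka.
Proof.
by split=> -[red core]; split=> //; [exact: clos_rt_rt1n|exact: clos_rt1n_rt].
Qed.

Lemma removes_confluent la nu1 nu2 :
    removes_ribbon n la nu1 -> removes_ribbon n la nu2 -> nu1 != nu2 ->
  exists xi, removes_ribbon n nu1 xi /\ removes_ribbon n nu2 xi.
Proof.
move=> /(removes_ribbonP n_gt0)[p1 up1 eq1] /(removes_ribbonP n_gt0)[p2 up2 eq2]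
  neq.
have neqp : p1 != p2.
  apply: contraNneq neq => eqp; apply/eqP/maya_of_inj.
  by rewrite -(upK up1) -(upK up2) -eq1 -eq2 eqp.
have down1 : can_down n p1 (maya_of la) by rewrite eq1 can_down_up.
have down2 : can_down n p2 (maya_of la) by rewrite eq2 can_down_up.
have nu1E : maya_of nu1 = down n p1 (maya_of la) by rewrite eq1 upK.
have nu2E : maya_of nu2 = down n p2 (maya_of la) by rewrite eq2 upK.
(* Tails at distance [n] would require one site to be both filled and empty. *)
have [neq12 neq21] : p1 != p2 + n%:Z /\ p2 != p1 + n%:Z.
  by split; apply/eqP => eqp; move: down1 down2;
    rewrite /can_down eqp => /andP[+ +] /andP[+ +]; do 4![case: (maya_of la _)].
have down21 : can_down n p2 (maya_of nu1).
  by move: down2; rewrite nu1E /can_down /down !ifF //; lia.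
have down12 : can_down n p1 (maya_of nu2).
  by move: down1; rewrite nu2E /can_down /down !ifF //; lia.
have [xi xiE rem1] := down_intpart n_gt0 down21.
have [xi' xiE' rem2] := down_intpart n_gt0 down12.
exists xi; split=> //; rewrite (_ : xi = xi') //.
apply: maya_of_inj; rewrite xiE xiE' nu1E nu2E; apply/funext => x;
  rewrite /down.
have [e1|n1] := eqVneq x p1; have [e2|n2] := eqVneq x p2 => //.
- by rewrite e1 (negbTE neq12).
- by rewrite e2 (negbTE neq21).
by case: (x == p1 + n%:Z); case: (x == p2 + n%:Z).
Qed.

(** Newman's argument: the one-step diamond suffices because each removal lowers the number of
    cells. *)
Lemma removes_core la nu ka : reduces la ka -> is_core ka ->
  removes_ribbon n la nu -> reduces nu ka.
Proof.
have [N] := ubnP (weight_of la); elim: N la nu ka => // N IHN la nu ka;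
  rewrite ltnS => leN.
case=> [core rem|la1 ka' rem1 red1 core rem]; first by case: core; exists nu.
have [->//|neq] := eqVneq nu la1.
have [xi [rem_nu rem_la1]] := removes_confluent rem rem1 neq.
apply: Relation_Operators.rt1n_trans rem_nu _; apply: (IHN la1) => //.
by have := weight_removes rem1; lia.
Qed.

Lemma core_exists la : exists ka, is_core_of n la ka.
Proof.
have [N] := ubnP (weight_of la); elim: N la => // N IHN la; rewrite ltnS => leN.
have [[nu rem]|core] := pselect (exists nu, removes_ribbon n la nu); last first.
  by exists la; apply/is_core_ofE; split=> //; exact: rt1n_refl.
have [|ka /is_core_ofE[red core]] := IHN nu;
  first by have := weight_removes rem; lia.
by exists ka; apply/is_core_ofE; split=> //;
  apply: Relation_Operators.rt1n_trans red.
Qed.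

Lemma ncoreP la : is_core_of n la (ncore n la).
Proof.
by apply: (@xgetPex _ la [set nu | is_core_of n la nu]%classic);
  exact: core_exists.
Qed.

Lemma ncore_removes la nu : removes_ribbon n la nu -> ncore n la = ncore n nu.
Proof.
move=> rem; rewrite /ncore.
have -> : [set ka | is_core_of n la ka]%classic =
  [set ka | is_core_of n nu ka]%classic.
  apply/seteqP; split=> ka /= /is_core_ofE[red core]; apply/is_core_ofE;
    split=> //.
    exact: removes_core red core rem.
  exact: Relation_Operators.rt1n_trans red.
(* Both sides choose from the same nonempty set, so their different default values do not enter. *)
have [ka kaP] := core_exists nu.
by rewrite /xget; case: pselect => // -[]; exists ka; apply/asboolP.
Qed.

Lemma ncore_moves t la mu : can_moves (can_up n) (up n) t (maya_of la) ->
  moves (up n) t (maya_of la) = maya_of mu -> ncore n mu = ncore n la.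
Proof.
elim: t la => [|p t IHt] la /=; first by move=> _ /maya_of_inj ->.
move=> /andP[canp]; have [nu <- /ncore_removes <-] := up_intpart n_gt0 canp.
exact: IHt.
Qed.

Lemma ncore_hstrip mu la : is_hstrip n mu la -> ncore n mu = ncore n la.
Proof. by move=> /(hstripP n_gt0)[t [_ cant]]; exact: ncore_moves. Qed.

Lemma ncore_vstrip mu la : is_vstrip n mu la -> ncore n mu = ncore n la.
Proof. by move=> /(vstripP n_gt0)[t [_ cant]]; exact: ncore_moves. Qed.

(** The last move of a nonempty sequence would exhibit a ribbon removable from the core. This
    settles the e-rule in zero variables. *)
Lemma core_vstrip ka la : is_core ka -> is_vstrip n ka la ->
  (vcount n ka la = 0)%N.
Proof.
move=> core strip; have [t [srt cant mvt]] := (vstripP n_gt0 ka la).1 strip.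
have [<- _] := vstrip_stats n_gt0 strip srt cant mvt.
case/lastP: t srt cant mvt => // t p _;
  rewrite -cats1 can_moves_cat moves_cat /= andbT.
move=> /andP[cant canp] eqka; case: core.
have [nu [nuE _ _]] := moves_intpart n_gt0 cant (leqnn _).
by exists nu; apply/(removes_ribbonP n_gt0); exists p; rewrite nuE.
Qed.

End Cores.

(** * Pieri rules *)

Lemma ops_coef0 n (A : comNzRingType) (q : A) can act ps (psi : maya -> A) s :
  uniq ps -> ops_coef n q can act ps 0 psi s = psi s.
Proof.
move=> /uniq_subs u_ps; rewrite /ops_coef big_mkcond (bigD1_seq [::]) ?mem_subs
  ?sub0seq //=.
rewrite mul1r big1 ?addr0 // => t neq;
  case: ifP => // /andP[_ /eqP/size0nil t0].
by rewrite t0 in neq.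
Qed.

(** * Tableau sums as iterated sums over strips *)

Section Chains.
Variables (A : idomainType) (q : A) (x : nat -> A) (n : nat) (ka : intpart).

Definition step_weight (i : nat) (mu la : intpart) : A :=
  q ^+ hspin n mu la * x i ^+ hcount n mu la.

(** Peels off the strip with the largest label. Variables are indexed by [nat] so that the ring [A]
    stays fixed while the number of labels varies in an induction. *)
Fixpoint chain_sum (l : nat) (la : intpart) : A :=
  if l is l'.+1 then
    \sum_(nu \in [set nu | is_hstrip n la nu]%classic)
      step_weight l' la nu * chain_sum l' nu
  else (la == ka)%:R.

Definition chain_weight l (T : {ffun 'I_l.+1 -> intpart}) : A :=
  \prod_(i < l) step_weight i (T (lift ord0 i)) (T (widen_ord (leqnSn l) i)).

Definition chain_rcons l (la : intpart) (T : {ffun 'I_l.+1 -> intpart}) :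
    {ffun 'I_l.+2 -> intpart} :=
  [ffun i => if unlift ord_max i is Some j then T j else la].

Lemma chain_rcons_max l la (T : {ffun 'I_l.+1 -> intpart}) :
  chain_rcons la T ord_max = la.
Proof. by rewrite ffunE unlift_none. Qed.

Lemma chain_rcons_widen l la (T : {ffun 'I_l.+1 -> intpart}) i :
  chain_rcons la T (widen_ord (leqnSn l.+1) i) = T i.
Proof.
rewrite ffunE (_ : widen_ord _ i = lift ord_max i) ?liftK //.
by apply: val_inj; rewrite /= /bump /= leqNgt ltn_ord.
Qed.

Lemma lift0_widen l (i : 'I_l) :
  lift ord0 (widen_ord (leqnSn l) i) = widen_ord (leqnSn l.+1) (lift ord0 i).
Proof. exact: val_inj. Qed.

Lemma lift0_max l : lift ord0 (@ord_max l) = ord_max.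
Proof. exact: val_inj. Qed.

Lemma ord0_widen l : ord0 = widen_ord (leqnSn l.+1) ord0.
Proof. exact: val_inj. Qed.

Lemma chain_rcons_weight l la (T : {ffun 'I_l.+1 -> intpart}) :
  chain_weight (chain_rcons la T) =
    step_weight l la (T ord_max) * chain_weight T.
Proof.
rewrite /chain_weight big_ord_recr /= mulrC lift0_max chain_rcons_max.
rewrite chain_rcons_widen; congr (_ * _); apply: eq_bigr => i _.
by rewrite lift0_widen !chain_rcons_widen.
Qed.

Lemma chain_rcons_ssrt l la (T : {ffun 'I_l.+1 -> intpart}) :
  is_ssrt n la ka (chain_rcons la T) <->
  is_hstrip n la (T ord_max) /\ is_ssrt n (T ord_max) ka T.
Proof.
split=> [[T0 _ steps]|[strip [T0 _ steps]]].
  split.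
    by have := steps ord_max; rewrite lift0_max chain_rcons_max
      chain_rcons_widen.
  split=> // [|i]; first by move: T0; rewrite ord0_widen chain_rcons_widen.
  by have := steps (widen_ord (leqnSn l) i);
    rewrite lift0_widen !chain_rcons_widen.
split; [by rewrite ord0_widen chain_rcons_widen|exact: chain_rcons_max|move=>
  i].
rewrite chain_rcons_widen; have [<-|/unlift_some[j ij _]] := eqVneq ord_max i.
  by rewrite lift0_max chain_rcons_max.
have -> : i = widen_ord (leqnSn l) j by rewrite ij; apply: val_inj;
  rewrite /= /bump /= leqNgt ltn_ord.
by rewrite lift0_widen chain_rcons_widen.
Qed.

Lemma chain_rcons_inj l la : injective (@chain_rcons l la).
Proof.
move=> T T' eqT; apply/ffunP => i.
by rewrite -(chain_rcons_widen la T) eqT chain_rcons_widen.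
Qed.

Lemma finite_hstrip_below la : finite_set [set nu | is_hstrip n la nu]%classic.
Proof.
by apply: sub_finite_set (finite_sub_intpart (diagram la)) => nu [].
Qed.

Lemma chain_sumE l la :
  \sum_(T \in [set T : {ffun 'I_l.+1 -> intpart} | is_ssrt n la ka T]%classic)
    chain_weight T = chain_sum l la.
Proof.
elim: l la => [|l IHl] la /=.
  have [->|neq] := eqVneq la ka.
    rewrite (_ : [set _ | _]%classic = [set [ffun=> ka]]%classic).
      by rewrite fsbig_set1 /chain_weight big_ord0.
    apply/seteqP; split=> T /=.
      move=> [T0 _ _]; apply/ffunP => i; rewrite ffunE -T0.
      by congr (T _); apply: val_inj; case: i => -[].
    by move=> ->; split=> [||[]//]; rewrite ffunE.
  rewrite fsbig1 // => T [T0 T1 _]; case/eqP: neq.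
  by rewrite -T0 -T1; congr (T _); exact: val_inj.
pose H := [set nu | is_hstrip n la nu]%classic.
pose D := [set T : {ffun 'I_l.+1 -> intpart} |
  is_hstrip n la (T ord_max) /\ is_ssrt n (T ord_max) ka T]%classic.
(* Exchanging the two sums requires finite index sets, as sums with infinite support take a default
   value. *)
have finD : finite_set D.
  apply: sub_finite_set (finite_preimage (f :=
    chain_rcons la) _ (finite_ssrt n l.+1 la ka)).
    by move=> T /chain_rcons_ssrt.
  by move=> T T' _ _; exact: chain_rcons_inj.
have finH : finite_set H by exact: finite_hstrip_below.
rewrite (reindex_fsbig (@chain_rcons l la) D); last first.
  split; [by move=> T /chain_rcons_ssrt|by move=> T T' _ _;
    exact: chain_rcons_inj|].
  move=> T ssT; pose T' := [ffun i => T (widen_ord (leqnSn l.+1) i)].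
  have TE : chain_rcons la T' = T.
    apply/ffunP => i; have [<-|/unlift_some[j ij _]] := eqVneq ord_max i.
      by rewrite chain_rcons_max; case: ssT.
    have -> : i = widen_ord (leqnSn l.+1) j by rewrite ij; apply: val_inj;
      rewrite /= /bump /= leqNgt ltn_ord.
    by rewrite chain_rcons_widen ffunE.
  by exists T' => //; apply/chain_rcons_ssrt; rewrite TE.
under [RHS]eq_fsbigr => nu Hnu.
  rewrite -IHl mulr_fsumr (_ : [set T | _]%classic = D `&` [set T :
    {ffun 'I_l.+1 -> intpart} | T ord_max = nu])%classic.
    rewrite fsbig_mkcondr; over.
  apply/seteqP; split=> T /=.
    by move=> ssT; have [_ TE _] := ssT; move: Hnu; rewrite inE /= /D /= TE.
  by move=> [[_ ssT] <-].
rewrite exchange_fsbig //; apply: eq_fsbigr => T; rewrite inE => -[strip ssT].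
rewrite chain_rcons_weight.
transitivity (\sum_(nu \in (H `&` [set T ord_max])%classic) step_weight l la nu
  * chain_weight T).
  rewrite (_ : H `&` _ = [set T ord_max])%classic ?fsbig_set1 //.
  by apply/seteqP; split=> nu /= => [[]//|->]; split.
rewrite fsbig_mkcondr; apply: eq_fsbigr => nu _.
by congr (if _ then _ else _); apply/idP/idP; rewrite !inE /= => ->.
Qed.

End Chains.

(** * The two rules for iterated sums *)

Section Pieri.
Variables (A : idomainType) (q : A) (x : nat -> A) (n : nat) (ka : intpart).
Hypothesis n_gt0 : (0 < n)%N.
Hypothesis ka_core : ~ exists nu, removes_ribbon n ka nu.

Local Notation chain := (chain_sum q x n ka).

Definition e_poly (l : nat) : {poly A} :=
  \prod_(i < l) gam q%:P ((x i)%:P * 'X) n.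

Lemma uniq_positions N : uniq (positions n N).
Proof.
have gt_tr : transitive (>%R : rel int) by move=> u v w; lia.
apply: (sorted_uniq gt_tr); first by move=> u; rewrite /= ltxx.
exact: sorted_descend.
Qed.

Lemma vstrip_sum0 (F : intpart -> A) la :
  \sum_(mu \in [set mu | is_vstrip n mu la /\ vcount n mu la = 0%N]%classic)
    q ^+ vspin n mu la * F mu = F la.
Proof.
have := @vstrip_ops n A q n_gt0 0 la (weight_of la) (F \o shape_of).
rewrite mul0n addn0 leqnn => /(_ isT);
  rewrite ops_coef0 ?uniq_positions //= shape_ofK.
by move=> ->; apply: eq_fsbigr => mu _; rewrite shape_ofK.
Qed.

Lemma hstrip_sum0 (F : intpart -> A) la :
  \sum_(mu \in [set mu | is_hstrip n mu la /\ hcount n mu la = 0%N]%classic)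
    q ^+ hspin n mu la * F mu = F la.
Proof.
have := @hstrip_ops n A q n_gt0 0 la (weight_of la) (F \o shape_of).
rewrite mul0n addn0 leqnn => /(_ isT).
rewrite ops_coef0 ?rev_uniq ?uniq_positions //= shape_ofK.
by move=> ->; apply: eq_fsbigr => mu _; rewrite shape_ofK.
Qed.

Lemma pieri_e l k la :
  \sum_(mu \in [set mu | is_vstrip n mu la /\ vcount n mu la = k]%classic)
    q ^+ vspin n mu la * chain l mu = (e_poly l)`_k * chain l la.
Proof.
elim: l k la => [|l IHl] k la.
  rewrite /e_poly big_ord0 coef1; case: k => [|k];
    first by rewrite vstrip_sum0 mul1r.
  rewrite mul0r fsbig1 // => mu [strip cnt] /=.
  case: eqP => [eqka|_]; last by rewrite mulr0.
  by rewrite eqka in strip cnt;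
    rewrite (core_vstrip n_gt0 ka_core strip) in cnt.
pose N := (weight_of la + k * n)%N; pose ps := positions n N.
(* The cut-off to actual diagrams with at most [N] cells secures the full leftmost window on the
   support of [psi]. It loses nothing, since no shape met here exceeds [la] with [k] ribbons
   added. *)
pose psi s := if (weight_of (shape_of s) <= N)%N &&
  `[< maya_of (shape_of s) = s >]
  then chain l (shape_of s) else 0.
have psiE mu : (weight_of mu <= N)%N -> psi (maya_of mu) = chain l mu.
  by rewrite /psi shape_ofK => ->; rewrite asboolT.
have remE mu : (weight_of mu <= N)%N ->
    remops n q (x l) ps psi (maya_of mu) = chain l.+1 mu.
  move=> leN; rewrite hstrip_remops //=; apply: eq_fsbigr => nu;
    rewrite inE /= => strip.
  by rewrite psiE //; have := hstrip_weight n_gt0 strip; lia.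
transitivity (ops_coef n q (can_up n) (up n) ps k (remops n q (x l) ps psi)
  (maya_of la)).
  rewrite (vstrip_ops q n_gt0 (N := N)) //; apply: eq_fsbigr => mu;
    rewrite inE => -[strip cnt].
  by rewrite remE //; have := vstrip_weight n_gt0 strip; rewrite cnt => ->.
rewrite /ps /positions ops_coef_remops //; last 2 first.
- by rewrite window_top // leq_addr.
- move=> s; rewrite /psi; case: ifP => [/andP[leN /asboolP <-] _|];
  last by rewrite eqxx.
  by rewrite window_bottom // shape_ofK.
rewrite -/(positions n N) -/ps.
have ops_e i nu : (i <= k)%N -> is_hstrip n la nu ->
    ops_coef n q (can_up n) (up n) ps i psi (maya_of nu) =
      (e_poly l)`_i * chain l nu.
  move=> lei strip; have wnu := hstrip_weight n_gt0 strip.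
  have leN : (weight_of nu + i * n <= N)%N by rewrite /N wnu; nia.
  rewrite (vstrip_ops q n_gt0 (N := N)) // -IHl; apply: eq_fsbigr => mu;
    rewrite inE => -[vs cnt].
  by rewrite psiE // (vstrip_weight n_gt0 vs) cnt.
have -> : e_poly l.+1 = gam q%:P ((x l)%:P * 'X) n * e_poly l.
  by rewrite /e_poly big_ord_recr /= mulrC.
rewrite coefM mulr_suml.
apply: eq_bigr => i _; rewrite hstrip_remops ?leq_addr // -mulrA; congr (_ * _).
rewrite [in RHS]mulr_fsumr; apply: eq_fsbigr => nu; rewrite inE /= => strip.
by rewrite ops_e ?leq_subr // /step_weight mulrCA.
Qed.

Lemma e_poly0 l : (e_poly l)`_0 = 1.
Proof.
rewrite -horner_coef0 /e_poly horner_prod big1 // => i _.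
by rewrite /gam horner_prod big1 // => j _; rewrite !hornerE.
Qed.

Lemma pieri_h l (h : nat -> A) :
    (forall d, \sum_(i < d.+1) h i * ((-1) ^+ (d - i) * (e_poly l)`_(d - i)) =
      (d == 0%N)%:R) ->
  forall k la,
  \sum_(mu \in [set mu | is_hstrip n mu la /\ hcount n mu la = k]%classic)
    q ^+ hspin n mu la * chain l mu = h k * chain l la.
Proof.
move=> hE; have h0 : h 0%N = 1.
  by have := hE 0%N; rewrite big_ord1 subn0 expr0 mul1r e_poly0 mulr1.
move=> k; have [b] := ubnP k; elim: b k => // b IHb k; rewrite ltnS => lekb la.
case: k lekb => [|k] lekb; first by rewrite hstrip_sum0 h0 mul1r.
pose N := (weight_of la + k.+1 * n)%N; pose ps := positions n N.
pose psi s := chain l (shape_of s).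
have hsumE i mu : (weight_of mu + i * n <= N)%N ->
    ops_coef n q (can_up n) (up n) (rev ps) i psi (maya_of mu) =
    \sum_(nu \in [set nu | is_hstrip n nu mu /\ hcount n nu mu = i]%classic)
      q ^+ hspin n nu mu * chain l nu.
  move=> leN; rewrite (hstrip_ops q n_gt0 (N := N)) //;
    apply: eq_fsbigr => nu _.
  by rewrite /psi shape_ofK.
(* The term with no vertical ribbon is the wanted sum. In every other term the horizontal strip has
   fewer ribbons, so the induction hypothesis followed by [pieri_e] evaluates it, and the recursion
   of [h] against the e's finishes. *)
have := ops_coef_cancel n q ps psi (maya_of la) (ltn0Sn k).
rewrite big_ord_recl subn0 expr0 mul1r ops_coef0 ?uniq_positions // hsumE //.
move=> /eqP; rewrite addr_eq0 => /eqP ->.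
have hErev : \sum_(i < k.+2) h (k.+1 - i)%N * ((-1) ^+ i * (e_poly l)`_i) = 0.
  rewrite -[RHS](hE k.+1) [RHS](reindex_inj rev_ord_inj);
    apply: eq_bigr => i _ /=.
  by rewrite subSS subKn // -ltnS.
have -> : h k.+1 = - \sum_(i < k.+1) h (k - i)%N * ((-1) ^+ i.+1 *
  (e_poly l)`_i.+1).
  apply/eqP; rewrite -addr_eq0; apply/eqP; move: hErev.
  by rewrite big_ord_recl /= subn0 expr0 mul1r e_poly0 mulr1.
rewrite mulNr mulr_suml; congr (- _).
apply: eq_bigr => i _; rewrite (vstrip_ops q n_gt0 (N := N)); last first.
  by rewrite /N leq_add2l leq_mul2r ltn_ord orbT.
rewrite lift0 subSS.
transitivity ((-1) ^+ i.+1 *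
  \sum_(mu \in [set mu | is_vstrip n mu la /\ vcount n mu la = i.+1]%classic)
   q ^+ vspin n mu la * (h (k - i)%N * chain l mu)).
  congr (_ * _); apply: eq_fsbigr => mu; rewrite inE => -[strip cnt].
  rewrite hsumE ?IHb //; first by lia.
  by rewrite (vstrip_weight n_gt0 strip) cnt /N; have := ltn_ord i; nia.
under eq_fsbigr do rewrite mulrCA.
by rewrite -mulr_fsumr pieri_e; ring.
Qed.

End Pieri.

(** * Specialisation to the generating functions of e and h *)

(** The substitution of -t for t is multiplicative. It turns the denominators of the h-series into
    the e-series. *)
Lemma coef_prod_alternate (A : comNzRingType) (m n : nat)
    (F G : 'I_m -> 'I_n -> {poly A}) :
    (forall i j k, (F i j)`_k = (-1) ^+ k * (G i j)`_k) ->
  forall k, (\prod_(i < m) \prod_(j < n) F i j)`_k =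
    (-1) ^+ k * (\prod_(i < m) \prod_(j < n) G i j)`_k.
Proof.
pose alt (p r : {poly A}) := forall k, p`_k = (-1) ^+ k * r`_k.
have alt1 : alt 1 1 by case=> [|k]; rewrite coef1 ?mul1r ?mulr0.
have altM p r p' r' : alt p r -> alt p' r' -> alt (p * p') (r * r').
  move=> ap ap' k; rewrite !coefM mulr_sumr; apply: eq_bigr => i _.
  have -> : (-1) ^+ k = (-1) ^+ i * (-1) ^+ (k - i) :> A.
    by rewrite -exprD subnKC // -ltnS.
  by rewrite ap ap'; ring.
move=> altF; apply: (big_ind2 alt) => // i _.
by apply: (big_ind2 alt) => // j _ k; exact: altF.
Qed.

Lemma bold_h_bold_e (K : comNzRingType) (q : K) (n m d : nat) :
  \sum_(i < d.+1) bold_h q n m i * ((-1) ^+ (d - i) * bold_e q n m (d - i)) =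
  (d == 0%N)%:R.
Proof.
rewrite -(bold_h_gen q n m d); apply: eq_bigr => i _; congr (_ * _).
apply/esym/coef_prod_alternate => {i}i j k.
rewrite coefB coefD coefCM coefX coef1.
by case: k => [|[|k]] /=; rewrite ?expr0 ?expr1; ring.
Qed.

Section MPoly.
Variables (K : idomainType) (q : K) (n m : nat).
Local Notation A := {mpoly K[m]}.

Definition mvar (i : nat) : A := if insub i is Some j then 'X_(j : 'I_m) else 0.

Lemma mvarE (i : 'I_m) : mvar i = 'X_i.
Proof. by rewrite /mvar valK. Qed.

Lemma ribbonG_skewE la ka :
  ribbonG_skew q n m la ka = chain_sum q%:MP mvar n ka m la.
Proof.
rewrite -chain_sumE /ribbonG_skew; apply: eq_fsbigr => T _.
rewrite -mul_mpolyC rmorphXn /ssrt_spin expr_sum mpolyXE_id /chain_weight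
  -big_split.
by apply: eq_bigr => i _; rewrite /step_weight mvarE mnmE.
Qed.

Lemma gam_mvar (i : 'I_m) :
  gam (q%:MP)%:P ((mvar i)%:P * 'X) n =
  \prod_(j < n) (1 + (q ^+ (2 * j) *: 'X_i : A)%:P * 'X).
Proof.
apply: eq_bigr => j _; rewrite mvarE -mul_mpolyC rmorphM /= !rmorphXn /=.
by congr (_ + _); rewrite mulrC mulrA.
Qed.

Lemma bold_eE k : bold_e q n m k = (e_poly q%:MP mvar n m)`_k.
Proof.
by rewrite /bold_e /e_poly; under [in RHS]eq_bigr do rewrite gam_mvar.
Qed.

Lemma bold_h_e_poly d :
  \sum_(i < d.+1) bold_h q n m i *
    ((-1) ^+ (d - i) * (e_poly q%:MP mvar n m)`_(d - i)) = (d == 0%N)%:R.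
Proof.
by rewrite -(bold_h_bold_e q n m d); apply: eq_bigr => i _; rewrite -bold_eE.
Qed.
End MPoly.

Local Close Scope fset_scope.

Theorem theorem29 (R : realType) (n : nat) (la : intpart) (k : nat)
    (n_ge1 : (1 <= n)%N) (k_ge1 : (1 <= k)%N) :
  forall m : nat,
    let q : Cq R := Cq_gen R in
    bold_h q n m k * ribbonG q n m la =
      \sum_(mu \in [set mu | is_hstrip n mu la /\ hcount n mu la = k]%classic)
         q ^+ hspin n mu la *: ribbonG q n m mu
    /\
    bold_e q n m k * ribbonG q n m la =
      \sum_(mu \in [set mu | is_vstrip n mu la /\ vcount n mu la = k]%classic)
         q ^+ vspin n mu la *: ribbonG q n m mu.
Proof.
move=> m q; rewrite /ribbonG !ribbonG_skewE.
(* Adding strips preserves the core, so every ribbon function in the identity is an iterated sum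
   starting from the core of [la]. *)
have [_ core] := ncoreP n_ge1 la; split.
  rewrite -(pieri_h n_ge1 core (bold_h_e_poly q n m)).
  apply: eq_fsbigr => mu; rewrite inE => -[strip _].
  by rewrite ribbonG_skewE (ncore_hstrip n_ge1 strip) -mul_mpolyC rmorphXn.
rewrite bold_eE -(pieri_e _ _ n_ge1 core); apply: eq_fsbigr => mu;
  rewrite inE => -[strip _].
by rewrite ribbonG_skewE (ncore_vstrip n_ge1 strip) -mul_mpolyC rmorphXn.
Qed.
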